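(* Let $n,d\ge 1$ be integers, let $\Delta=\{(t,s)\in\mathbb{R}^2: 0\le s\le t<+\infty\}$, let $H:\Delta\to\mathbb{R}^{n\times n}$ be continuous, and let $B=(B_1,\dots,B_d)$ be a $d$-dimensional vector of mutually independent standard Brownian motions. Suppose that there exists $H_\infty\in C([0,\infty);\mathbb{R}^{n\times n})$ such that for each $f\in BC([0,\infty);\mathbb{R}^{n\times d})$, $$\lim_{t\to\infty}\int_0^t H(t,s)f(s)\,dB(s)=\int_0^\infty H_\infty(s)f(s)\,dB(s)\quad\text{almost surely}.$$ Then, with this $H_\infty$, $$\lim_{t\to\infty}\int_0^t \|H(t,s)-H_\infty(s)\|^2\,ds=0,$$ and for each $f\in BC([0,\infty);\mathbb{R}^{n\times d})$, $$\lim_{t\to\infty}\mathbb{E}\left[\left\|\int_0^t H(t,s)f(s)\,dB(s)-\int_0^\infty H_\infty(s)f(s)\,dB(s)\right\|^2\right]=0.$$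
   Context: $C([0,\infty);\mathbb{R}^{n\times n})$ is the space of continuous $\mathbb{R}^{n\times n}$-valued functions on $[0,\infty)$, and $BC([0,\infty);\mathbb{R}^{n\times d})$ is the space of bounded continuous $\mathbb{R}^{n\times d}$-valued functions on $[0,\infty)$. $\|\cdot\|$ denotes the Euclidean norm on vectors and the Frobenius norm on matrices. $H$ and $f$ are deterministic; for each fixed $t$, $X_f(t)=\int_0^t H(t,s)f(s)\,dB(s)$ is the $\mathbb{R}^n$-valued It\^o integral (with respect to the natural filtration of $B$) of the deterministic integrand $s\mapsto H(t,s)f(s)$. It is implicit in the hypothesis that the stochastic integral $\int_0^\infty H_\infty(s)f(s)\,dB(s)$, i.e. the almost sure limit of $\int_0^T H_\infty(s)f(s)\,dB(s)$ as $T\to\infty$, exists for every $f\in BC([0,\infty);\mathbb{R}^{n\times d})$. A process $X$ converges almost surely to $X_\infty$ if there is a $\mathbb{P}$-null set $\Omega_0$ such that $\lim_{t\to\infty}X(t,\omega)=X_\infty(\omega)$ for all $\omega\notin\Omega_0$; in the hypothesis this is required of (some version of) the process $(X_f(t))_{t\ge 0}$. *)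

(* Defs.v *)
From HB Require Import structures.
From mathcomp Require Import all_boot all_order all_algebra.
From mathcomp Require Import all_classical all_reals all_analysis.

Set Implicit Arguments.
Unset Strict Implicit.
Unset Printing Implicit Defensive.

Import Order.TTheory GRing.Theory Num.Theory.
Import numFieldNormedType.Exports.

Local Open Scope classical_set_scope.
Local Open Scope ring_scope.

(* The library norm `|A| on matrices is the max norm; on column vectors
   frobenius_norm is the Euclidean norm. *)
Definition frobenius_norm (R : realType) (m n : nat) (A : 'M[R]_(m, n)) : R :=
  Num.sqrt (\sum_i \sum_j A i j ^+ 2).

Definition bounded_continuous (R : realType) (m n : nat)
    (f : R -> 'M[R]_(m, n)) : Prop :=
  {within `[0, +oo[, continuous f} /\
  exists M : R, forall s : R, 0 <= s -> frobenius_norm (f s) <= M.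

Definition sigma_of (R : realType) (Omega J : Type) (Y : J -> Omega -> R)
    (D : set J) : set (set Omega) :=
  <<s \bigcup_(j in D) preimage_set_system setT (Y j) measurable >>.

Definition natural_filtration (R : realType) (Omega I : Type)
    (B : I -> R -> Omega -> R) (t : R) : set (set Omega) :=
  sigma_of (fun p : I * R => B p.1 p.2) [set p | 0 <= p.2 <= t].

(* Only the values b t with 0 <= t matter.  The second argument of normal_prob
   is the standard deviation. *)
Definition standard_brownian_motion (R : realType) (d' : measure_display)
    (Omega : measurableType d') (P : probability Omega R)
    (b : R -> Omega -> R) : Prop :=
  [/\ forall t, 0 <= t -> measurable_fun setT (b t),
      {ae P, forall w, b 0 w = 0},
      forall s t, 0 <= s -> s < t ->
        forall A C, sigma_of b `[0, s] A -> measurable C ->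
        P (A `&` (fun w => b t w - b s w)%R @^-1` C) =
        (P A * P ((fun w => b t w - b s w)%R @^-1` C))%E,
      forall s t, 0 <= s -> s < t -> forall C, measurable C ->
        P ((fun w => b t w - b s w)%R @^-1` C) =
        normal_prob 0 (Num.sqrt (t - s)) C
    & {ae P, forall w, {within `[0, +oo[, continuous (fun t => b t w)}}].

(* Taking A k = setT for some of the indices gives the product rule for every
   subfamily. *)
Definition mutually_independent_processes (R : realType)
    (d' : measure_display) (Omega : measurableType d')
    (P : probability Omega R) (d : nat) (B : 'I_d -> R -> Omega -> R) : Prop :=
  forall A : 'I_d -> set Omega,
    (forall k, sigma_of (B k) `[0, +oo[ (A k)) ->
    P (\bigcap_k A k) = (\prod_(k < d) P (A k))%E.

Definition brownian_vector (R : realType) (d' : measure_display)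
    (Omega : measurableType d') (P : probability Omega R) (d : nat)
    (B : 'I_d -> R -> Omega -> R) : Prop :=
  (forall k, standard_brownian_motion P (B k)) /\
  mutually_independent_processes P B.

(* Simple adapted process on [0, t]:
   sum of sp_coef i * 1_(]sp_time i, sp_time i.+1]) over i < sp_size. *)
Record simple_process (R : realType) (Omega : Type)
    (F : R -> set (set Omega)) (t : R) := SimpleProcess {
  sp_size : nat;
  sp_time : nat -> R;
  sp_coef : nat -> Omega -> R;
  sp_time_homo : {homo sp_time : i j / (i <= j)%N >-> i <= j};
  sp_time_ge0 : 0 <= sp_time 0;
  sp_time_le : sp_time sp_size <= t;
  sp_coef_adapted : forall i, (i < sp_size)%N ->
    forall C : set R, measurable C -> F (sp_time i) (sp_coef i @^-1` C);
  sp_coef_bounded : exists M : R, forall i w, (i < sp_size)%N ->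
    `|sp_coef i w| <= M }.

Definition sp_val (R : realType) (Omega : Type) (F : R -> set (set Omega))
    (t : R) (S : simple_process F t) (s : R) (w : Omega) : R :=
  \sum_(i < sp_size S)
    sp_coef S i w * \1_(`]sp_time S i, sp_time S i.+1]) s.

Definition sp_integral (R : realType) (Omega : Type)
    (F : R -> set (set Omega)) (t : R) (S : simple_process F t)
    (b : R -> Omega -> R) (w : Omega) : R :=
  \sum_(i < sp_size S)
    sp_coef S i w * (b (sp_time S i.+1) w - b (sp_time S i) w).

(* Y is (a version of) the Ito integral of phi with respect to b over [0, t]:
   the L^2(P)-limit of the integrals of simple F-adapted processes that
   converge to phi in L^2([0, t] x Omega).  For jointly measurable phi, such
   an approximation exists iff phi is (up to null sets) F-adapted with
   E int_0^t phi^2 < oo. *)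
Definition is_ito_integral (R : realType) (d' : measure_display)
    (Omega : measurableType d') (P : probability Omega R)
    (F : R -> set (set Omega)) (b : R -> Omega -> R)
    (phi : R -> Omega -> R) (t : R) (Y : Omega -> R) : Prop :=
  measurable_fun setT Y /\
  exists S : nat -> simple_process F t,
    ((fun k => \int[P]_w \int[lebesgue_measure]_(s in `[0%R, t])
        ((sp_val (S k) s w - phi s w)%R ^+ 2)%:E)%E @ \oo --> 0%E) /\
    ((fun k => \int[P]_w ((sp_integral (S k) b w - Y w)%R ^+ 2)%:E)%E
        @ \oo --> 0%E).

(* Integral over [0, t] of an n x d matrix process against the d-dimensional
   B, with respect to the natural filtration of the whole vector B. *)
Definition is_ito_integral_mx (R : realType) (d' : measure_display)
    (Omega : measurableType d') (P : probability Omega R) (n d : nat)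
    (B : 'I_d -> R -> Omega -> R) (G : R -> Omega -> 'M[R]_(n, d)) (t : R)
    (Y : Omega -> 'cV[R]_n) : Prop :=
  forall i : 'I_n, exists Z : 'I_d -> Omega -> R,
    (forall k, is_ito_integral P (natural_filtration B) (B k)
                 (fun s w => G s w i k) t (Z k)) /\
    (forall w, Y w i 0 = \sum_k Z k w).

(* Integral over [0, oo[, as the almost sure limit of (some version of) the
   process of integrals over [0, t]. *)
Definition is_improper_ito_integral_mx (R : realType) (d' : measure_display)
    (Omega : measurableType d') (P : probability Omega R) (n d : nat)
    (B : 'I_d -> R -> Omega -> R) (G : R -> Omega -> 'M[R]_(n, d))
    (Y : Omega -> 'cV[R]_n) : Prop :=
  (forall i, measurable_fun setT (fun w => Y w i 0)) /\
  exists X : R -> Omega -> 'cV[R]_n,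
    (forall t, 0 <= t -> is_ito_integral_mx P B G t (X t)) /\
    {ae P, forall w, X t w @[t --> +oo%R] --> Y w}.

(* Main.v *)
Require Import Defs.
From HB Require Import structures.
From mathcomp Require Import all_boot all_order all_algebra.
From mathcomp Require Import all_classical all_reals all_analysis.
From mathcomp Require Import measurable_realfun.
From mathcomp Require Import ring lra.

Import Order.TTheory GRing.Theory Num.Theory.
Import numFieldNormedType.Exports.

Local Open Scope classical_set_scope.
Local Open Scope ring_scope.

(** The heart of the matter is that Gaussian variables which converge almost
surely converge in mean square.  Both conclusions follow from this, because the
Ito integral of a deterministic integrand is Gaussian and its second moment is,
by the Ito isometry, the squared L2 norm of the integrand.  For the kernels it
is then enough to test the hypothesis on constant matrices: with
f = delta_mx j k, the k-th integrand of row i of (H - Hinf) f is the entry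
(i, j) of H - Hinf.

No law other than that of a single increment is ever computed.  All that is
used of a Gaussian variable X is the moment bound E X^4 <= C (E X^2)^2 with a
constant C that does not depend on X.  It holds for finite linear combinations
of values of the Brownian motions (gauss_span_kurtosis_le): when the terms are
sorted, Abel summation writes such a combination as a sum of successively
independent increments, and the bound survives the addition of an independent
increment.  By the Paley-Zygmund inequality the moment bound prevents E X^2
from staying away from 0 while X becomes small in probability.  The class
gaussian below is the L2 closure of these combinations; it is stable under
subtraction and the anticoncentration passes to the closure
(L2_closure_anticoncentration).  Hence an almost sure limit of elements of the
class is an L2 limit and belongs to the class (L2_closure_ae_cvg,
L2_closure_cvg0); this is applied to the integrals of Hinf f over [0, m] as m
goes to infinity, and then to the differences X t - Xinf.

An Ito integral is given as the L2 limit of integrals of adapted step processes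
with random coefficients.  The isometry (ito_isometry) allows one to replace
these by deterministic step functions that are uniformly close to the continuous
integrand (ito_approx).  This shows at once that the integral is determined up
to a null set, that it lies in the class gaussian, and, through the isometry for
the difference of two deterministic step functions, that the squared L2 distance
of two integrands is at most a constant times the squared L2 distance of their
integrals (row_lower_bound). *)

(** * Moments of the normal law *)

Section normal_moments.
Context {R : realType}.
Local Notation mu := (@lebesgue_measure R).

Import HBNNSimple.

Lemma ge0_integral_normal_prob (s : R) (f : _ -> \bar R) :
  measurable_fun setT f -> (forall x, 0 <= f x)%E ->
  (\int[normal_prob 0 s]_x f x = \int[mu]_x (f x * (normal_pdf 0 s x)%:E))%E.
Proof.
move=> mf f0; pose f_ := nnsfun_approx measurableT mf.
have mp : measurable_fun setT (fun x => (normal_pdf 0 s x)%:E).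
  by apply/measurable_EFinP; exact: measurable_normal_pdf.
have p0 x : (0 <= (normal_pdf 0 s x)%:E)%E by rewrite lee_fin normal_pdf_ge0.
have cvgf x : EFin \o f_^~ x @ \oo --> f x by apply: cvg_nnsfun_approx.
have ndf x : {homo (fun n => (f_ n x)%:E) : a b / (a <= b)%N >-> (a <= b)%E}.
  by move=> a b ab; rewrite lee_fin; exact/lefP/nd_nnsfun_approx.
transitivity (limn (fun n => \int[normal_prob 0 s]_x (f_ n x)%:E))%E.
  rewrite -monotone_convergence//=.
  - by apply: eq_integral => x _; apply/esym/cvg_lim => //; exact: cvgf.
  - by move=> n; exact/measurable_EFinP.
  - by move=> n x _; rewrite lee_fin.
transitivity (limn (fun n => \int[mu]_x ((f_ n x)%:E * (normal_pdf 0 s x)%:E)))%E;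
    last first.
  rewrite -monotone_convergence//=.
  - apply: eq_integral => x _; apply/cvg_lim => //.
    by apply: cvgeZr => //; exact: cvgf.
  - by move=> n; apply: emeasurable_funM => //; exact/measurable_EFinP.
  - by move=> n x _; rewrite mule_ge0// lee_fin.
  - by move=> x _ a b ab; rewrite lee_wpmul2r//; exact: ndf.
congr (limn _); apply/funext => n.
under eq_integral do rewrite fimfunE -fsumEFin//.
under [RHS]eq_integral => x _.
  rewrite fimfunE -fsumEFin// ge0_mule_fsuml; last first.
    by move=> r; rewrite EFinM nnfun_muleindic_ge0.
  over.
rewrite !ge0_integral_fsum//=; last 4 first.
  - move=> r; apply: emeasurable_funM => //.
    by apply/measurable_EFinP/measurable_funM.
  - by move=> r x _; rewrite mule_ge0// EFinM nnfun_muleindic_ge0.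
  - by move=> r; apply/measurable_EFinP/measurable_funM.
  - by move=> r x _; rewrite EFinM nnfun_muleindic_ge0.
apply: eq_fsbigr => r _.
under [RHS]eq_integral do rewrite EFinM -muleA.
rewrite integralZl_indic_nnsfun//= integral_indic//= setIT.
have [r0|r0] := leP 0 r.
  rewrite ge0_integralZl//; last 2 first.
    by apply: emeasurable_funM => //; exact/measurable_EFinP.
    by move=> x _; rewrite mule_ge0// lee_fin.
  congr *%E; rewrite [LHS]/normal_prob [LHS]integral_mkcond; apply: eq_integral => x _.
  by rewrite patchE indicE; case: ifPn => _; rewrite ?mul1e ?mul0e.
rewrite preimage_nnfun0//.
rewrite measure0 mule0 integral0_eq// => x _.
by rewrite indic0 mul0e mule0.
Qed.
(** Substituting x -> s x turns the standard normal density into that of standard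
deviation s.  Only this scaling of the moments enters the proof, never their
actual values. *)
Lemma even_moment_normal_prob (s : R) (j : nat) : 0 < s ->
  (\int[normal_prob 0 s]_x (x ^+ j.*2)%:E =
   (s ^+ j.*2)%:E * \int[normal_prob 0 1]_x (x ^+ j.*2)%:E)%E.
Proof.
move=> s0; have sn0 : s != 0 by rewrite gt_eqF.
have even_ge0 (x : R) : 0 <= x ^+ j.*2 by rewrite -mul2n exprM exprn_ge0 ?sqr_ge0.
have mXj : measurable_fun setT (fun x : R => (x ^+ j.*2)%:E).
  by apply/measurable_EFinP; exact: measurable_funX.
rewrite !ge0_integral_normal_prob//; try by move=> x; rewrite lee_fin.
have F'E : (( *%R s) : R -> R)^`()%classic = cst s.
  by apply/funext => x; rewrite derive1E deriveM// derive_cst derive_id scaler0 addr0 scaler1.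
under eq_integral do rewrite -EFinM.
rewrite (@increasing_ge0_integration_by_substitutionT _ ( *%R s)); first last.
- by move=> x; rewrite mulr_ge0// normal_pdf_ge0.
- move=> x; apply: cvgM; first exact: exprn_continuous.
  exact: continuous_normal_pdf.
- exact/gt0_cvgMry.
- exact/gt0_cvgMrNy.
- by move=> x; exact: derivableM.
- by rewrite F'E; exact: is_cvg_cst.
- by rewrite F'E; exact: is_cvg_cst.
- by rewrite F'E => ?; exact: cvg_cst.
- by move=> x y xy; rewrite ltr_pM2l.
rewrite -ge0_integralZl//=; first last.
- by rewrite lee_fin.
- by move=> x _; rewrite mule_ge0 ?lee_fin// normal_pdf_ge0.
- apply: emeasurable_funM => //; apply/measurable_EFinP.
  exact: measurable_normal_pdf.
apply: eq_integral => x _; rewrite F'E !fctE/= -!EFinM; congr EFin.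
rewrite exprMn -!mulrA; congr (_ * (_ * _)).
rewrite normal_pdfE// normal_pdfE ?oner_neq0// /normal_peak /normal_fun !subr0.
have -> : - (s * x) ^+ 2 / (s ^+ 2 *+ 2) = - x ^+ 2 / (1 ^+ 2 *+ 2).
  by field; rewrite sn0.
rewrite mulrAC; congr (_ * _).
rewrite -!mulrnAr sqrtrM ?sqr_ge0// sqrtr_sqr gtr0_norm//.
by rewrite expr1n mul1r invfM mulrAC mulVf// mul1r.
Qed.

(** The polynomial is absorbed by part of the exponential: x^4 times the standard
normal density is at most a constant times the normal density of standard
deviation 2. *)
Lemma fourth_moment_normal_prob_lty :
  (\int[normal_prob 0 (1 : R)]_x (x ^+ 4)%:E < +oo)%E.
Proof.
have x4 (x : R) : 0 <= x ^+ 4 by rewrite (exprM x 2 2) sqr_ge0.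
have mx4 : measurable_fun setT (fun x : R => (x ^+ 4)%:E).
  by apply/measurable_EFinP; exact: measurable_funX.
have mp (s : R) : measurable_fun setT (fun x : R => (normal_pdf 0 s x)%:E).
  by apply/measurable_EFinP; exact: measurable_normal_pdf.
rewrite ge0_integral_normal_prob//.
pose K : R := 64 * normal_peak 1 / normal_peak 2.
have K0 : 0 <= K by rewrite divr_ge0 ?mulr_ge0 ?normal_peak_ge0.
apply: (@le_lt_trans _ _ (\int[mu]_x (K%:E * (normal_pdf 0 2 x)%:E))%E); last first.
  rewrite ge0_integralZl//; [|exact: mp|by move=> x _; rewrite lee_fin normal_pdf_ge0].
  by rewrite integral_normal_pdf mule1 ltry.
apply: ge0_le_integral => //=.
- by move=> x _; rewrite mule_ge0 ?lee_fin// normal_pdf_ge0.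
- by apply: emeasurable_funM => //; exact: mp.
- by apply: emeasurable_funM => //; exact: mp.
move=> x _; rewrite -!EFinM lee_fin normal_pdfE ?oner_neq0// normal_pdfE//.
rewrite /normal_fun !subr0 /K.
have -> : 64 * normal_peak 1 / normal_peak 2 *
    (normal_peak 2 * expR (- x ^+ 2 / (2 ^+ 2 *+ 2))) =
    normal_peak 1 * (64 * expR (- x ^+ 2 / (2 ^+ 2 *+ 2))) :> R.
  by field; rewrite gt_eqF// normal_peak_gt0.
rewrite mulrCA ler_wpM2l ?normal_peak_ge0//.
(* The exponent splits as - x^2/8 = 3x^2/16 + 3x^2/16 - x^2/2, and both extra
   factors are bounded below by expR_ge1Dx. *)
have -> : - x ^+ 2 / (2 ^+ 2 *+ 2) =
    3 * x ^+ 2 / 16 + 3 * x ^+ 2 / 16 + - x ^+ 2 / (1 ^+ 2 *+ 2) by field.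
rewrite 2!expRD mulrA ler_wpM2r ?expR_ge0//.
have y0 := sqr_ge0 x; rewrite (_ : x ^+ 4 = x ^+ 2 ^+ 2); last by rewrite -exprM.
move: (x ^+ 2) y0 => y y0; have := expR_ge1Dx (3 * y / 16).
move: (expR _) => e he.
by nra.
Qed.

Lemma second_moment_normal_prob_gt0 :
  (0 < \int[normal_prob 0 (1 : R)]_x (x ^+ 2)%:E)%E.
Proof.
have mx2 : measurable_fun setT (fun x : R => (x ^+ 2)%:E).
  by apply/measurable_EFinP; exact: measurable_funX.
have mp : measurable_fun setT (fun x : R => (normal_pdf 0 1 x)%:E).
  by apply/measurable_EFinP; exact: measurable_normal_pdf.
rewrite ge0_integral_normal_prob//; last by move=> x; rewrite lee_fin sqr_ge0.
pose c : R := normal_pdf 0 1 2.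
have c0 : 0 < c.
  by rewrite /c normal_pdfE ?oner_neq0// mulr_gt0 ?expR_gt0// normal_peak_gt0 ?oner_neq0.
apply: (@lt_le_trans _ _ (\int[mu]_(x in `[1%R, 2%R]) c%:E)%E).
  rewrite integral_cst//= lebesgue_measure_itv/= lte_fin ltr1n.
  by rewrite -EFinB -EFinM lte_fin mulr_gt0// subr_gt0 ltr1n.
apply: (@le_trans _ _ (\int[mu]_(x in `[1%R, 2%R])
    ((x ^+ 2)%:E * (normal_pdf 0 1 x)%:E))%E); last first.
  apply: ge0_subset_integral => //=; first exact: emeasurable_funM.
  by move=> x _; rewrite mule_ge0 ?lee_fin ?sqr_ge0// normal_pdf_ge0.
apply: ge0_le_integral => //=.
- by move=> x _; rewrite lee_fin ltW.
- by apply/measurable_funTS; exact: emeasurable_funM.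
move=> x; rewrite in_itv/= => /andP[x1 x2].
rewrite -EFinM lee_fin /c normal_pdfE ?oner_neq0// mulrCA.
rewrite ler_wpM2l ?normal_peak_ge0//.
rewrite -[leLHS]mul1r ler_pM ?expR_ge0//; first by rewrite exprn_ege1.
rewrite ler_expR !subr0 expr1n ler_pM2r// lerN2.
by rewrite ler_pXn2r// nnegrE// (le_trans _ x1).
Qed.

(** The integrals of the positive and of the negative part are exchanged by
x -> - x; they cancel because they are finite, |x| being at most 1 + x^4. *)
Lemma mean_normal_prob (s : R) : 0 < s -> (\int[normal_prob 0 s]_x x%:E = 0)%E.
Proof.
move=> sgt0; have s0 : s != 0 by rewrite gt_eqF.
have mp : measurable_fun setT (fun x : R => (normal_pdf 0 s x)%:E).
  by apply/measurable_EFinP; exact: measurable_normal_pdf.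
have mid : measurable_fun setT (fun x : R => x%:E) by exact/measurable_EFinP.
have p0 x : (0 <= (normal_pdf 0 s x)%:E)%E by rewrite lee_fin normal_pdf_ge0.
have cp x : {for x, continuous (fun x => `|x| * normal_pdf 0 s x)}.
  apply: cvgM; first exact: norm_continuous.
  exact: continuous_normal_pdf.
rewrite integralE !ge0_integral_normal_prob//=;
  try by [exact: measurable_funepos|exact: measurable_funeneg].
rewrite (_ : (\int[mu]_x _ =
    \int[mu]_(x in `[0%R, +oo[) (`|x| * normal_pdf 0 s x)%:E)%E); last first.
  rewrite [RHS]integral_mkcond; apply: eq_integral => x _.
  rewrite patchE funeposE; case: ifPn; rewrite ?inE ?notin_setE/= in_itv/= andbT.
    by move=> x0; rewrite ger0_norm// max_l// lee_fin.
  by move=> /negP; rewrite -ltNge => x0; rewrite max_r ?mul0e// lee_fin ltW.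
rewrite (_ : (\int[mu]_x _ =
    \int[mu]_(x in `]-oo, (- 0)%R]) (`|x| * normal_pdf 0 s x)%:E)%E); last first.
  rewrite [RHS]integral_mkcond; apply: eq_integral => x _.
  rewrite patchE funenegE oppr0; case: ifPn; rewrite ?inE ?notin_setE/= in_itv/=.
    by move=> x0; rewrite ler0_norm// max_l// lee_fin oppr_ge0.
  by move=> /negP; rewrite -ltNge => x0; rewrite max_r ?mul0e// lee_fin oppr_le0 ltW.
rewrite ge0_integration_by_substitutionNy; last 2 first.
  by apply: continuous_subspaceT => x; exact: cp.
  by move=> x _; rewrite mulr_ge0// normal_pdf_ge0.
set A := (\int[mu]_(x in _) _)%E; set A' := (\int[mu]_(x in _) _)%E.
have -> : A' = A.
  apply: eq_integral => x _ /=; rewrite normrN; congr (_ * _)%:E.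
  by rewrite !normal_pdfE// /normal_fun !subr0 sqrrN.
rewrite subee// ge0_fin_numE; last first.
  by apply: integral_ge0 => x _; rewrite lee_fin mulr_ge0// normal_pdf_ge0.
have m4 : measurable_fun setT (fun x : R => (1 + x ^+ 4)%:E).
  by apply/measurable_EFinP; apply: measurable_funD => //; exact: measurable_funX.
have x4 (x : R) : 0 <= x ^+ 4 by rewrite (exprM x 2 2) sqr_ge0.
apply: (@le_lt_trans _ _ (\int[normal_prob 0 s]_x (1 + x ^+ 4)%:E)%E).
  rewrite ge0_integral_normal_prob//; last by move=> x; rewrite lee_fin addr_ge0.
  rewrite /A integral_mkcond; apply: ge0_le_integral => //=.
  - by move=> x _; apply: erestrict_ge0 => y _; rewrite lee_fin mulr_ge0// normal_pdf_ge0.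
  - apply/(measurable_restrictT _ _).1 => //; apply: measurable_funTS.
    apply/measurable_EFinP; apply: measurable_funM; last exact: measurable_normal_pdf.
    exact: normr_measurable.
  - by apply: emeasurable_funM => //; exact: mp.
  move=> x _; rewrite patchE; case: ifPn => _; last first.
    by rewrite -EFinM lee_fin mulr_ge0 ?normal_pdf_ge0// addr_ge0.
  rewrite -EFinM lee_fin ler_wpM2r ?normal_pdf_ge0//.
  rewrite (_ : x ^+ 4 = `|x| ^+ 4); last by rewrite -normrX ger0_norm.
  have := sqr_ge0 (`|x| ^+ 2 - 2^-1); have := sqr_ge0 (`|x| - 2^-1); nra.
under eq_integral do rewrite EFinD.
rewrite ge0_integralD//; last 2 first.
  by move=> x _; rewrite lee_fin.
  by apply/measurable_EFinP; exact: measurable_funX.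
rewrite integral_cst// mul1e; apply: lte_add_pinfty.
  by have := @probability_setT _ _ _ (normal_prob (0 : R) s) => /= ->; rewrite ltry.
rewrite (even_moment_normal_prob s 2)// lte_mul_pinfty// ?lee_fin//.
exact: fourth_moment_normal_prob_lty.
Qed.
End normal_moments.

(** * Expectation of real random variables, independence *)

Section expectation.
Context {R : realType} {d' : measure_display} {Omega : measurableType d'}.
Variable P : probability Omega R.
Implicit Types (f g : Omega -> R) (c : R).

Definition integ (f : Omega -> R) := P.-integrable setT (EFin \o f).
Definition Ex (f : Omega -> R) : R := \int[P]_w f w.

Lemma integ_meas f : integ f -> measurable_fun setT f.
Proof. by move=> /measurable_int/measurable_EFinP. Qed.

Lemma eq_integ f g : f =1 g -> integ f -> integ g.
Proof. by move=> /funext ->. Qed.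

Lemma eq_Ex f g : f =1 g -> Ex f = Ex g.
Proof. by move=> /funext ->. Qed.

Lemma ExE f : integ f -> (\int[P]_w (f w)%:E)%E = (Ex f)%:E.
Proof. by move=> If; rewrite fineK//; exact: integrable_fin_num. Qed.

Lemma integ_le f g : measurable_fun setT f -> (forall w, `|f w| <= g w) ->
  integ g -> integ f.
Proof.
move=> mf fg; apply: le_integrable => //; first exact/measurable_EFinP.
by move=> w _ /=; rewrite lee_fin (le_trans (fg w))// ler_norm.
Qed.

Lemma integ_cst c : integ (fun=> c).
Proof. exact: finite_measure_integrable_cst. Qed.

Lemma integD f g : integ f -> integ g -> integ (fun w => f w + g w).
Proof. exact: integrableD. Qed.

Lemma integZ c f : integ f -> integ (fun w => c * f w).
Proof. exact: integrableZl. Qed.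

Lemma integ_sum (I : Type) (s : seq I) (f : I -> Omega -> R) :
  (forall i, integ (f i)) -> integ (fun w => \sum_(i <- s) f i w).
Proof.
move=> If; elim: s => [|i s IH].
  by apply: (eq_integ (fun=> 0)) (integ_cst 0) => w; rewrite big_nil.
by apply: eq_integ (integD _ _ (If i) IH) => w; rewrite big_cons.
Qed.

Lemma Ex_cst c : Ex (fun=> c) = c.
Proof. by rewrite /Ex Rintegral_cst//= probability_setT mulr1. Qed.

Lemma ExD f g : integ f -> integ g -> Ex (fun w => f w + g w) = Ex f + Ex g.
Proof. by move=> If Ig; rewrite /Ex RintegralD. Qed.

Lemma ExZ c f : integ f -> Ex (fun w => c * f w) = c * Ex f.
Proof. by move=> If; rewrite /Ex RintegralZl. Qed.

Lemma Ex_sum (I : Type) (s : seq I) (f : I -> Omega -> R) :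
  (forall i, integ (f i)) ->
  Ex (fun w => \sum_(i <- s) f i w) = \sum_(i <- s) Ex (f i).
Proof.
move=> If; elim: s => [|i s IH].
  by rewrite big_nil -[RHS](Ex_cst 0); apply: eq_Ex => w; rewrite big_nil.
rewrite big_cons -IH -ExD//; last exact: integ_sum.
by apply: eq_Ex => w; rewrite big_cons.
Qed.

Lemma Ex_ge0 f : (forall w, 0 <= f w) -> 0 <= Ex f.
Proof. by move=> f0; apply: Rintegral_ge0. Qed.

Lemma le_Ex f g : integ f -> integ g -> (forall w, f w <= g w) -> Ex f <= Ex g.
Proof. by move=> If Ig fg; apply: le_Rintegral. Qed.

Definition L4 (f : Omega -> R) :=
  measurable_fun setT f /\ integ (fun w => f w ^+ 4).

Lemma L4_pow f j : L4 f -> (j <= 4)%N -> integ (fun w => f w ^+ j).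
Proof.
move=> [mf If] j4; apply: (integ_le _ (fun w => 1 + f w ^+ 4)).
- exact: measurable_funX.
- move=> w; rewrite normrX (_ : f w ^+ 4 = `|f w| ^+ 4); last first.
    by rewrite -normrX ger0_norm// (exprM _ 2 2) sqr_ge0.
  move: (normr_ge0 (f w)); move: `|f w| => /= y y0; have [y1|y1] := leP y 1.
    by apply: (@le_trans _ _ 1); rewrite ?exprn_ile1// ler_wpDr// exprn_ge0.
  by rewrite (le_trans (ler_weXn2l (ltW y1) j4))// ler_wpDl.
- exact: integD (integ_cst 1) If.
Qed.

Lemma L4_cst c : L4 (fun=> c).
Proof. by split => //; exact: integ_cst. Qed.

Lemma L4D f g : L4 f -> L4 g -> L4 (fun w => f w + g w).
Proof.
move=> [mf If] [mg Ig]; split; first exact: measurable_funD.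
apply: (integ_le _ (fun w => 8 * f w ^+ 4 + 8 * g w ^+ 4)).
- by apply: measurable_funX; exact: measurable_funD.
- move=> w; rewrite ger0_norm; last by rewrite (exprM _ 2 2) sqr_ge0.
  by have := sqr_ge0 (f w - g w); have := sqr_ge0 (f w + g w);
    have := sqr_ge0 (f w ^+ 2 - g w ^+ 2); nra.
- by apply: integD; apply: integZ.
Qed.

Lemma L4Z c f : L4 f -> L4 (fun w => c * f w).
Proof.
move=> [mf If]; split; first exact: measurable_funM.
by apply: eq_integ (integZ (c ^+ 4) _ If) => w; rewrite exprMn.
Qed.

End expectation.

Section independence.
Context {R : realType} {d' : measure_display} {Omega : measurableType d'}.
Variable P : probability Omega R.
Local Notation integ := (integ P).
Local Notation Ex := (Ex P).

(** By independence the joint law of W and xi is the product of their laws, so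
that the expectation of W xi is a double integral to which Fubini applies. *)
Lemma indep_ExM (W xi : Omega -> R) : integ W -> integ xi ->
  (forall A C, measurable A -> measurable C ->
     P (W @^-1` A `&` xi @^-1` C) = (P (W @^-1` A) * P (xi @^-1` C))%E) ->
  integ (fun w => W w * xi w) /\ Ex (fun w => W w * xi w) = Ex W * Ex xi.
Proof.
move=> IW Ixi ind.
have mW := integ_meas _ _ IW; have mxi := integ_meas _ _ Ixi.
pose W' : {RV P >-> R} := HB.pack W (isMeasurableFun.Build _ _ _ _ _ mW).
pose xi' : {RV P >-> R} := HB.pack xi (isMeasurableFun.Build _ _ _ _ _ mxi).
pose m1 := distribution P W'; pose m2 := distribution P xi'.
have mp : measurable_fun setT (fun w => (W w, xi w)) by exact: measurable_fun_pair.
pose WX : {mfun Omega >-> (R * R)%type} :=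
  HB.pack (fun w => (W w, xi w)) (isMeasurableFun.Build _ _ _ _ _ mp).
have mE A : measurable A -> (m1 \x m2)%E A = distribution P WX A.
  by apply: product_measure_unique => B C mB mC; rewrite -ind.
pose f (z : R * R) := (z.1 * z.2)%:E.
have mf : measurable_fun setT f.
  by apply/measurable_EFinP; apply: measurable_funM.
have Im1 : m1.-integrable setT EFin by apply: integrable_pushforward.
have Im2 : m2.-integrable setT EFin by apply: integrable_pushforward.
have If : (m1 \x m2)%E.-integrable setT f.
  apply/integrable12ltyP => //=.
  rewrite (eq_integral (fun x : R => `|x|%:E * \int[m2]_y `|y|%:E)%E); last first.
    move=> x _; rewrite -ge0_integralZl//.
      by apply: eq_integral => y _; rewrite normrM EFinM.
    by apply/measurable_EFinP; exact: normr_measurable.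
  have /integrableP[_ fin1] := Im1; have /integrableP[_ fin2] := Im2.
  rewrite ge0_integralZr//.
  - by rewrite lte_mul_pinfty// ?integral_ge0// ge0_fin_numE// integral_ge0.
  - by apply/measurable_EFinP; exact: normr_measurable.
  - exact: integral_ge0.
have IWX : integ (fun w => W w * xi w).
  apply/integrableP; split; first by apply/measurable_EFinP/measurable_funM.
  have /integrableP[_] := If.
  rewrite (eq_measure_integral (distribution P WX)); last by move=> A mA _; exact: mE.
  by rewrite ge0_integral_pushforward//; exact: measurableT_comp.
split => //; apply: EFin_inj; rewrite -ExE// EFinM -ExE// -ExE//.
have -> : (\int[P]_w (W w * xi w)%:E = \int[m1 \x m2]_z f z)%E.
  rewrite (eq_measure_integral (distribution P WX)); last by move=> A mA _; exact: mE.
  by rewrite integral_pushforward.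
rewrite -integral12_prod_meas1// /fubini_F /=.
have EW : (\int[P]_w (W w)%:E = \int[m1]_x x%:E)%E by rewrite integral_pushforward.
have Exi : (\int[P]_w (xi w)%:E = \int[m2]_x x%:E)%E by rewrite integral_pushforward.
rewrite EW Exi.
rewrite (eq_integral (fun x : R => x%:E * \int[m2]_y y%:E)%E); last first.
  by move=> x _; rewrite -integralZl.
rewrite -{1}(fineK (integrable_fin_num _ Im2))//.
by rewrite integralZr// fineK//; exact: integrable_fin_num.
Qed.

End independence.

(** * The past of a Brownian vector *)

Section sigma_of_theory.
Context {R : realType} {d' : measure_display} {Omega : measurableType d'}.
Context {J : Type}.
Variable Y : J -> Omega -> R.
Implicit Type D : set J.

Definition meas_wrt (G : set (set Omega)) (W : Omega -> R) :=
  forall C, measurable C -> G (W @^-1` C).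

Lemma sigma_of_gen D j : D j -> meas_wrt (sigma_of Y D) (Y j).
Proof.
move=> Dj C mC; apply: sub_sigma_algebra; exists j => //; exists C => //.
by rewrite setTI.
Qed.

Lemma sigma_of_sub D (G : set (set Omega)) : sigma_algebra setT G ->
  (forall j, D j -> meas_wrt G (Y j)) -> sigma_of Y D `<=` G.
Proof.
move=> sG DG; apply: smallest_sub => // A [j Dj [C mC <-]].
by rewrite setTI; exact: DG.
Qed.

Lemma sigma_of_algebra D : sigma_algebra setT (sigma_of Y D).
Proof. exact: smallest_sigma_algebra. Qed.

Lemma sigma_of_mono D D' : D `<=` D' -> sigma_of Y D `<=` sigma_of Y D'.
Proof.
move=> DD'; apply: sigma_of_sub (sigma_of_algebra _) _ => j /DD' D'j.
exact: sigma_of_gen.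
Qed.

Lemma sigma_of_measurable D : (forall j, D j -> measurable_fun setT (Y j)) ->
  sigma_of Y D `<=` measurable.
Proof.
move=> mY; apply: sigma_of_sub; first exact: sigma_algebra_measurable.
by move=> j /mY mYj C mC; rewrite -[X in measurable X]setTI; exact: mYj.
Qed.

Lemma sigma_ofT D : sigma_of Y D setT.
Proof.
have [h0 hC _] := sigma_of_algebra D.
by have := hC _ h0; rewrite setD0.
Qed.

Let gen D := \bigcup_(j in D) preimage_set_system setT (Y j) measurable.

Lemma sigma_ofI D A C : sigma_of Y D A -> sigma_of Y D C ->
  sigma_of Y D (A `&` C).
Proof. exact: (@measurableI _ (g_sigma_algebraType (gen D))). Qed.

Lemma meas_wrtP D W : meas_wrt (sigma_of Y D) W <->
  measurable_fun (setT : set (g_sigma_algebraType (gen D))) W.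
Proof.
split=> [h _ C mC|h C mC]; first by rewrite setTI; exact: h.
by have := h measurableT C mC; rewrite setTI.
Qed.

Lemma meas_wrt_cst D c : meas_wrt (sigma_of Y D) (fun=> c).
Proof. by apply/meas_wrtP. Qed.

Lemma meas_wrtD D f g : meas_wrt (sigma_of Y D) f -> meas_wrt (sigma_of Y D) g ->
  meas_wrt (sigma_of Y D) (fun w => f w + g w).
Proof. by move=> /meas_wrtP mf /meas_wrtP mg; apply/meas_wrtP/measurable_funD. Qed.

Lemma meas_wrtM D f g : meas_wrt (sigma_of Y D) f -> meas_wrt (sigma_of Y D) g ->
  meas_wrt (sigma_of Y D) (fun w => f w * g w).
Proof. by move=> /meas_wrtP mf /meas_wrtP mg; apply/meas_wrtP/measurable_funM. Qed.

Lemma meas_wrtB D f g : meas_wrt (sigma_of Y D) f -> meas_wrt (sigma_of Y D) g ->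
  meas_wrt (sigma_of Y D) (fun w => f w - g w).
Proof. by move=> /meas_wrtP mf /meas_wrtP mg; apply/meas_wrtP/measurable_funB. Qed.

Lemma meas_wrt_sum D (I : Type) (s : seq I) (f : I -> Omega -> R) :
  (forall i, meas_wrt (sigma_of Y D) (f i)) ->
  meas_wrt (sigma_of Y D) (fun w => \sum_(i <- s) f i w).
Proof.
move=> mf; elim: s => [|i s IH].
  rewrite (_ : (fun w => _) = fun=> 0); first exact: meas_wrt_cst.
  by apply/funext => w; rewrite big_nil.
rewrite (_ : (fun w => _) = fun w => f i w + \sum_(i <- s) f i w).
  exact: meas_wrtD.
by apply/funext => w; rewrite big_cons.
Qed.

Lemma meas_wrt_sub (G G' : set (set Omega)) W : G `<=` G' ->
  meas_wrt G W -> meas_wrt G' W.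
Proof. by move=> GG' mW C /mW /GG'. Qed.

Lemma meas_wrt_measurable (G : set (set Omega)) W : G `<=` measurable ->
  meas_wrt G W -> measurable_fun setT W.
Proof. by move=> Gm mW _ C mC; rewrite setTI; apply/Gm/mW. Qed.

End sigma_of_theory.

Section brownian.
Context {R : realType} {d' : measure_display} {Omega : measurableType d'}.
Context {P : probability Omega R} {d : nat} {B : 'I_d -> R -> Omega -> R}.
Hypothesis hB : brownian_vector P B.

(** What is known when the k-th motion has been observed until time s and all the
others forever.  Keeping the other motions in full makes this sigma-algebra
serve both for conditioning on the natural filtration and for comparing
increments of two different motions. *)
Definition past (k : 'I_d) (s : R) : set (set Omega) :=
  sigma_of (fun p : 'I_d * R => B p.1 p.2)
    [set p | 0 <= p.2 /\ (p.1 = k -> p.2 <= s)].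

Definition incr k s t (w : Omega) := B k t w - B k s w.

Lemma meas_B k t : 0 <= t -> measurable_fun setT (B k t).
Proof. by have [/(_ k)[+ _ _ _ _] _] := hB; apply. Qed.

Lemma past_measurable k s : past k s `<=` measurable.
Proof. by apply: sigma_of_measurable => -[j u] [/= u0 _]; exact: meas_B. Qed.

Lemma meas_incr k s t : 0 <= s -> 0 <= t -> measurable_fun setT (incr k s t).
Proof. by move=> s0 t0; apply: measurable_funB; exact: meas_B. Qed.

Lemma past_incr j k s u v : 0 <= u -> 0 <= v ->
  (j = k -> u <= s /\ v <= s) -> meas_wrt (past k s) (incr j u v).
Proof.
move=> u0 v0 jk; apply: meas_wrtB.
  by apply: (@sigma_of_gen _ _ _ _ _ _ (j, v)); split => //= /jk[].
by apply: (@sigma_of_gen _ _ _ _ _ _ (j, u)); split => //= /jk[].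
Qed.

Lemma filtration_past k s t : s <= t -> natural_filtration B s `<=` past k t.
Proof.
move=> st; apply: sigma_of_mono => -[j u] /= /andP[u0 us]; split => // _.
exact: le_trans us st.
Qed.

Let cell k s (F : 'I_d -> set Omega) := forall j,
  sigma_of (B j) [set u | 0 <= u /\ (j = k -> u <= s)] (F j).

Let cells k s : set (set Omega) :=
  [set A | exists F, cell k s F /\ A = \bigcap_j F j].

(** The sets F_1 /\ ... /\ F_d, with F_k observed on [0, s] and the other F_j on
[0, oo[, form a pi-system that generates the past.  On such a set the claim is
the independence of the processes together with the independence of the
increment of B k from its own past; two finite measures that agree on a
pi-system agree on the sigma-algebra it generates. *)
Lemma indep_past k s t A C : 0 <= s -> s < t -> past k s A -> measurable C ->
  P (A `&` incr k s t @^-1` C) = (P A * P (incr k s t @^-1` C))%E.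
Proof.
move=> s0 st sA mC; have t0 : 0 <= t by rewrite (le_trans s0)// ltW.
have cell_meas F j : cell k s F -> measurable (F j).
  by move=> /(_ j); apply: sigma_of_measurable => u [u0 _]; exact: meas_B.
have mE : measurable (incr k s t @^-1` C).
  by rewrite -[X in measurable X]setTI; exact: meas_incr.
have cellsT : cells k s setT.
  by exists (fun=> setT); split; [move=> j; exact: sigma_ofT|apply/seteqP; split => // w _ j _].
have subA : past k s `<=` <<s cells k s >>.
  apply: sigma_of_sub; first exact: smallest_sigma_algebra.
  move=> [j u] [/= u0 jk] X mX; apply: sub_sigma_algebra.
  exists (fun i => if i == j then B j u @^-1` X else setT); split.
    move=> i; have [->|_] := eqVneq i j; last exact: sigma_ofT.
    by apply: (@sigma_of_gen _ _ _ _ (B j)) mX; split.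
  apply/seteqP; split => [w Xw i _|w /(_ j I)]; last by rewrite eqxx.
  by case: eqVneq.
pose r : {nonneg R} := NngNum (fine_ge0 (measure_ge0 P (incr k s t @^-1` C))).
have rE : r%:num%:E = P (incr k s t @^-1` C).
  by rewrite /r/= fineK//; exact: fin_num_measure.
have cells_meas : cells k s `<=` measurable.
  move=> X [F [cF ->]]; apply: fin_bigcap_measurable => // j _.
  exact: cell_meas.
have cover : \bigcup_(_ : nat) (setT : set Omega) = setT.
  by apply/seteqP; split => // w _; exists 0.
have cellsI : setI_closed (cells k s).
  move=> _ _ [F [cF ->]] [F' [cF' ->]]; exists (fun j => F j `&` F' j).
  by split; [move=> j; exact: sigma_ofI|rewrite bigcapI].
rewrite -rE muleC.
apply: (@g_sigma_algebra_measure_unique _ _ _ _ cells_meas _ (fun=> cellsT)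
  cover (mrestr P mE) (mscale r P) cellsI _ _ A (subA _ sA)).
- move=> X [F [cF ->]]; rewrite /= /mrestr /mscale.
  have [/(_ k)[_ _ hind _ _] hmut] := hB.
  pose F' j := if j == k then F j `&` incr k s t @^-1` C else F j.
  have cF0 j : sigma_of (B j) `[0, +oo[ (F j).
    apply: sigma_of_mono (cF j) => u [u0 _] /=; by rewrite in_itv/= u0.
  have cF' j : sigma_of (B j) `[0, +oo[ (F' j).
    rewrite /F'; have [->|//] := eqVneq j k; apply: sigma_ofI => //.
    have : meas_wrt (sigma_of (B k) `[0, +oo[) (incr k s t).
      by apply: meas_wrtB; apply: sigma_of_gen => /=; rewrite in_itv/= ?s0 ?t0.
    exact.
  have -> : \bigcap_j F j `&` incr k s t @^-1` C = \bigcap_j F' j.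
    apply/seteqP; split => [w [Fw Cw] j _|w F'w].
      by rewrite /F'; have [->|_] := eqVneq j k; [split => //; exact: Fw|exact: Fw].
    split; last by have := F'w k I; rewrite /F' eqxx => -[].
    by move=> j _; have := F'w j I; rewrite /F'; case: eqP => // -> [].
  change (P (\bigcap_j F' j) = ((r%:num)%:E * P (\bigcap_j F j))%E).
  rewrite (hmut _ cF') (hmut _ cF0) (bigD1 k)//= [in RHS](bigD1 k)//= muleA /F' eqxx.
  congr (_ * _)%E.
    rewrite rE muleC; apply: hind => //.
    by apply: sigma_of_mono (cF k) => u [u0 /(_ erefl)] us /=; rewrite in_itv/= u0.
  by apply: eq_bigr => j /negbTE ->.
- by move=> _; rewrite /= /mrestr setTI (le_lt_trans (probability_le1 _ _))// ltry.
Qed.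

End brownian.

Arguments past {R d' Omega d} B k s _.
Arguments incr {R d' Omega d} B k s t w.

(** The absolute constants 1 and 3 for j = 2 and j = 4, kept abstract. *)
Definition normal_moment {R : realType} (j : nat) : R :=
  fine (\int[normal_prob 0 (1 : R)]_x (x ^+ j)%:E)%E.

(** * Moments of Brownian increments *)

Section standard_moments.
Context {R : realType}.

Let integral_ge1D (f : R -> R) : measurable_fun setT f -> (forall x, 0 <= f x) ->
  (forall x, f x <= 1 + x ^+ 4) -> (\int[normal_prob 0 (1 : R)]_x (f x)%:E < +oo)%E.
Proof.
move=> mf f0 f1.
have x4 (x : R) : 0 <= x ^+ 4 by rewrite (exprM x 2 2) sqr_ge0.
apply: (@le_lt_trans _ _ (\int[normal_prob 0 (1 : R)]_x (1%:E + (x ^+ 4)%:E))%E).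
  apply: ge0_le_integral => //=.
  - by move=> x _; rewrite lee_fin.
  - exact/measurable_EFinP.
  - apply: emeasurable_funD => //; apply/measurable_EFinP.
    exact: measurable_funX.
  - by move=> x _; rewrite -EFinD lee_fin.
rewrite ge0_integralD//; last 2 first.
  by move=> x _; rewrite lee_fin.
  by apply/measurable_EFinP; exact: measurable_funX.
rewrite integral_cst// mul1e; apply: lte_add_pinfty.
  by have := @probability_setT _ _ _ (normal_prob (0 : R) 1) => /= ->; rewrite ltry.
exact: fourth_moment_normal_prob_lty.
Qed.

Lemma normal_moment2E :
  (\int[normal_prob 0 (1 : R)]_x (x ^+ 2)%:E)%E = (normal_moment 2)%:E :> \bar R.
Proof.
rewrite fineK// ge0_fin_numE; last by apply: integral_ge0 => x _; rewrite lee_fin sqr_ge0.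
apply: integral_ge1D => [|x|x]; [exact: measurable_funX|exact: sqr_ge0|].
by have := sqr_ge0 (x ^+ 2 - 1); have := sqr_ge0 x; nra.
Qed.

Lemma normal_moment4E :
  (\int[normal_prob 0 (1 : R)]_x (x ^+ 4)%:E)%E = (normal_moment 4)%:E :> \bar R.
Proof.
rewrite fineK// ge0_fin_numE; first exact: fourth_moment_normal_prob_lty.
by apply: integral_ge0 => x _; rewrite lee_fin (exprM x 2 2) sqr_ge0.
Qed.

Lemma normal_moment2_gt0 : 0 < normal_moment 2 :> R.
Proof. by rewrite -lte_fin -normal_moment2E second_moment_normal_prob_gt0. Qed.

Lemma normal_moment4_ge0 : 0 <= normal_moment 4 :> R.
Proof.
by apply/fine_ge0/integral_ge0 => x _; rewrite lee_fin (exprM x 2 2) sqr_ge0.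
Qed.

End standard_moments.

Section increments.
Context {R : realType} {d' : measure_display} {Omega : measurableType d'}.
Context {P : probability Omega R} {d : nat} {B : 'I_d -> R -> Omega -> R}.
Hypothesis hB : brownian_vector P B.
Local Notation integ := (integ P).
Local Notation Ex := (Ex P).
Local Notation incr := (incr B).
Local Notation past := (past B).
Local Notation m2 := (@normal_moment R 2).
Local Notation m4 := (@normal_moment R 4).

Lemma incr_law k s t : 0 <= s -> s < t ->
  forall A, measurable A ->
  pushforward P (incr k s t) A = normal_prob 0 (Num.sqrt (t - s)) A.
Proof. by move=> s0 st A mA; have [/(_ k)[_ _ _ + _] _] := hB; apply. Qed.

Lemma incr_even_moment k s t j : 0 <= s -> s < t ->
  (\int[P]_w (incr k s t w ^+ j.*2)%:E =
   ((t - s) ^+ j)%:E * \int[normal_prob 0 1]_x (x ^+ j.*2)%:E)%E.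
Proof.
move=> s0 st; have mI : measurable_fun setT (incr k s t).
  by apply: (meas_incr hB) => //; rewrite (le_trans s0)// ltW.
have ev (x : R) : (0 <= (x ^+ j.*2)%:E)%E.
  by rewrite lee_fin -mul2n exprM exprn_ge0// sqr_ge0.
have mX : measurable_fun setT (fun x : R => (x ^+ j.*2)%:E).
  by apply/measurable_EFinP; exact: measurable_funX.
pose X : {RV P >-> measurableTypeR R} :=
  HB.pack (incr k s t) (isMeasurableFun.Build _ _ Omega (measurableTypeR R) (incr k s t) mI).
transitivity (\int[distribution P X]_x (x ^+ j.*2)%:E)%E.
  by rewrite ge0_integral_pushforward.
transitivity (\int[normal_prob 0 (Num.sqrt (t - s))]_x (x ^+ j.*2)%:E)%E.
  apply: eq_measure_integral; move=> A mA _; exact: (incr_law k s t s0 st A mA).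
rewrite even_moment_normal_prob ?sqrtr_gt0 ?subr_gt0//.
by rewrite -mul2n exprM sqr_sqrtr// subr_ge0 ltW.
Qed.

Lemma incr_eq k s : incr k s s = fun=> 0.
Proof. by apply/funext => w; rewrite /incr subrr. Qed.

Lemma incr_L4 k s t : 0 <= s -> s <= t -> L4 P (incr k s t).
Proof.
move=> s0; rewrite le_eqVlt => /predU1P[<-|st].
  by rewrite incr_eq; exact: L4_cst.
have t0 : 0 <= t by rewrite (le_trans s0)// ltW.
have mI := meas_incr hB k s t s0 t0.
split => //; apply/integrableP; split.
  by apply/measurable_EFinP; exact: measurable_funX.
under eq_integral => w _.
  rewrite /= ger0_norm; last by rewrite (exprM _ 2 2) sqr_ge0.
  over.
rewrite (incr_even_moment k s t 2)// normal_moment4E.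
by rewrite -EFinM ltry.
Qed.

Lemma incr_integ k s t j : 0 <= s -> s <= t -> (j <= 4)%N ->
  integ (fun w => incr k s t w ^+ j).
Proof. by move=> s0 st j4; apply: L4_pow => //; exact: incr_L4. Qed.

Lemma Ex_incr k s t : 0 <= s -> s <= t -> Ex (incr k s t) = 0.
Proof.
move=> s0; rewrite le_eqVlt => /predU1P[<-|st].
  by rewrite incr_eq Ex_cst.
have t0 : 0 <= t by rewrite (le_trans s0)// ltW.
have mI := meas_incr hB k s t s0 t0.
have II : integ (incr k s t) by apply: (incr_integ k s t 1) => //; exact: ltW.
apply: EFin_inj; rewrite -ExE//.
pose X : {RV P >-> measurableTypeR R} :=
  HB.pack (incr k s t) (isMeasurableFun.Build _ _ Omega (measurableTypeR R) (incr k s t) mI).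
transitivity (\int[distribution P X]_x x%:E)%E.
  by rewrite integral_pushforward.
transitivity (\int[normal_prob 0 (Num.sqrt (t - s))]_x x%:E)%E.
  apply: eq_measure_integral; move=> A mA _; exact: (incr_law k s t s0 st A mA).
by rewrite mean_normal_prob// sqrtr_gt0 subr_gt0.
Qed.

Lemma Ex_incr2 k s t : 0 <= s -> s <= t ->
  Ex (fun w => incr k s t w ^+ 2) = m2 * (t - s).
Proof.
move=> s0; rewrite le_eqVlt => /predU1P[<-|st].
  by rewrite incr_eq expr0n/= Ex_cst subrr mulr0.
apply: EFin_inj; rewrite -ExE; last by apply: incr_integ => //; exact: ltW.
by rewrite (incr_even_moment k s t 1)// expr1 normal_moment2E EFinM muleC.
Qed.

Lemma Ex_incr4 k s t : 0 <= s -> s <= t ->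
  Ex (fun w => incr k s t w ^+ 4) = m4 * (t - s) ^+ 2.
Proof.
move=> s0; rewrite le_eqVlt => /predU1P[<-|st].
  by rewrite incr_eq expr0n/= Ex_cst subrr expr0n mulr0.
apply: EFin_inj; rewrite -ExE; last by apply: incr_integ => //; exact: ltW.
by rewrite (incr_even_moment k s t 2)// normal_moment4E EFinM muleC.
Qed.

Lemma indep_incr k s t W (phi : R -> R) : 0 <= s -> s <= t ->
  meas_wrt (past k s) W -> integ W -> measurable_fun setT phi ->
  integ (fun w => phi (incr k s t w)) ->
  integ (fun w => W w * phi (incr k s t w)) /\
  Ex (fun w => W w * phi (incr k s t w)) = Ex W * Ex (fun w => phi (incr k s t w)).
Proof.
move=> s0; rewrite le_eqVlt => /predU1P[<- mW IW _ _|st mW IW mphi Iphi].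
  rewrite !incr_eq; split.
    by apply: eq_integ (integZ P (phi 0) _ IW) => w; rewrite mulrC.
  rewrite Ex_cst mulrC -ExZ//; apply: eq_Ex => w; exact: mulrC.
apply: indep_ExM => // A C mA mC.
have : measurable (phi @^-1` C) by rewrite -[X in measurable X]setTI; exact: mphi.
by move=> /(indep_past hB k s t _ _ s0 st (mW _ mA)).
Qed.

(** An increment is independent of the past and centred. *)
Lemma martingale_incr k s t W : 0 <= s -> s <= t ->
  meas_wrt (past k s) W -> integ W ->
  integ (fun w => W w * incr k s t w) /\ Ex (fun w => W w * incr k s t w) = 0.
Proof.
move=> s0 st mW IW.
have mid : measurable_fun setT (idfun : R -> R) by exact: measurable_id.
have [] := indep_incr k s t W idfun s0 st mW IW mid (incr_integ k s t 1 s0 st isT).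
by rewrite /= Ex_incr// mulr0.
Qed.

End increments.

(** * Elementary integrals and the Ito isometry *)

Section steps.
Context {R : realType} {d' : measure_display} {Omega : measurableType d'}.
Context {d : nat} (B : 'I_d -> R -> Omega -> R).

(** One term of an elementary integrand: coef on the interval ]lft, rgt] in the
direction dir.  Integrands are arbitrary sequences of such terms, with possibly
overlapping intervals, so that a difference of two integrands is a
concatenation and no common refinement of partitions is needed. *)
Record step := Step {
  dir : 'I_d;
  lft : R;
  rgt : R;
  coef : Omega -> R;
  lft_ge0 : 0 <= lft;
  lft_rgt : lft <= rgt;
  coef_adapted : meas_wrt (natural_filtration B lft) coef;
  coef_bounded : exists M, forall w, `|coef w| <= M }.

Definition step_int (x : step) w := coef x w * incr B (dir x) (lft x) (rgt x) w.
Definition steps_int (L : seq step) w := \sum_(x <- L) step_int x w.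
Definition steps_val (L : seq step) k s w :=
  \sum_(x <- L | dir x == k) coef x w * \1_(`]lft x, rgt x]) s.
(** The length of the intersection of the two intervals. *)
Definition overlap (x y : step) :=
  Num.max 0 (Num.min (rgt x) (rgt y) - Num.max (lft x) (lft y)).

Lemma overlapC x y : overlap x y = overlap y x.
Proof. by rewrite /overlap minC (maxC (lft x)). Qed.

(** The integral over s of the square of steps_val L k s w (see steps_sqrE),
written as a finite sum. *)
Definition steps_sqr (L : seq step) k w :=
  \sum_(x <- L | dir x == k) \sum_(y <- L | dir y == k)
    coef x w * coef y w * overlap x y.

Lemma indic_overlap x y s :
  \1_(`]lft x, rgt x]) s * \1_(`]lft y, rgt y]) s =
  \1_(`]Num.max (lft x) (lft y), Num.min (rgt x) (rgt y)]) s :> R.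
Proof.
rewrite -[LHS]/((\1_(`]lft x, rgt x]) \* \1_(`]lft y, rgt y])) s) -indicI.
congr (\1_ _ _); apply/seteqP; split => u /=; rewrite !in_itv/=.
  by case=> /andP[? ?] /andP[? ?]; rewrite gt_max le_min; apply/andP; split; apply/andP.
by rewrite gt_max le_min => /andP[/andP[-> ->] /andP[-> ->]].
Qed.

Lemma integrable_overlap x y : lebesgue_measure.-integrable setT
  (fun s : R => (\1_(`]lft x, rgt x]) s * \1_(`]lft y, rgt y]) s)%:E).
Proof.
apply: eq_integrable (@integrable_indic_itv R (Num.max (lft x) (lft y))
  (Num.min (rgt x) (rgt y)) false false) => // s _ /=.
by rewrite indic_overlap.
Qed.

Lemma integral_overlap x y :
  (\int[lebesgue_measure]_s
     (\1_(`]lft x, rgt x]) s * \1_(`]lft y, rgt y]) s)%:E = (overlap x y)%:E)%E.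
Proof.
set a := Num.max (lft x) (lft y); set b := Num.min (rgt x) (rgt y).
transitivity (\int[lebesgue_measure]_s (\1_(`]a, b]) s)%:E)%E.
  by apply: eq_integral => s _; rewrite indic_overlap.
rewrite integral_indic//= setIT lebesgue_measure_itv/= lte_fin /overlap -/a -/b.
have [ab|ba] := ltP a b; first by rewrite -EFinB max_r// subr_ge0 ltW.
by rewrite max_l// subr_le0.
Qed.

Lemma steps_sqrE L k w :
  (\int[lebesgue_measure]_s ((steps_val L k s w) ^+ 2)%:E =
   (steps_sqr L k w)%:E)%E.
Proof.
have I x y : lebesgue_measure.-integrable setT (fun s : R =>
    (coef x w * coef y w * (\1_(`]lft x, rgt x]) s * \1_(`]lft y, rgt y]) s))%:E).
  under eq_fun do rewrite EFinM; apply: integrableZl => //.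
  exact: integrable_overlap.
transitivity (\int[lebesgue_measure]_s (\sum_(x <- L | dir x == k)
    \sum_(y <- L | dir y == k)
    (coef x w * coef y w * (\1_(`]lft x, rgt x]) s * \1_(`]lft y, rgt y]) s))%:E))%E.
  apply: eq_integral => s _; under eq_bigr do rewrite sumEFin.
  rewrite sumEFin; congr EFin; rewrite expr2 /steps_val big_distrlr/=.
  by apply: eq_bigr => x _; apply: eq_bigr => y _; rewrite mulrACA.
rewrite integral_sum//; last by move=> x; apply: integrable_sum => // y _; exact: I.
rewrite /steps_sqr -sumEFin; apply: eq_bigr => x _.
rewrite integral_sum// -sumEFin; apply: eq_bigr => y _.
under eq_integral do rewrite EFinM.
by rewrite integralZl ?integral_overlap -?EFinM//; exact: integrable_overlap.
Qed.

End steps.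

Arguments lft {R d' Omega d B}.
Arguments rgt {R d' Omega d B}.
Arguments dir {R d' Omega d B}.
Arguments coef {R d' Omega d B}.
Arguments lft_ge0 {R d' Omega d B}.
Arguments lft_rgt {R d' Omega d B}.
Arguments coef_adapted {R d' Omega d B}.
Arguments coef_bounded {R d' Omega d B}.
Arguments step_int {R d' Omega d B}.
Arguments steps_int {R d' Omega d B}.
Arguments steps_val {R d' Omega d B}.
Arguments overlap {R d' Omega d B}.
Arguments overlapC {R d' Omega d B}.
Arguments steps_sqr {R d' Omega d B}.
Arguments integral_overlap {R d' Omega d B}.
Arguments steps_sqrE {R d' Omega d B}.

Section isometry.
Context {R : realType} {d' : measure_display} {Omega : measurableType d'}.
Context {P : probability Omega R} {d : nat} {B : 'I_d -> R -> Omega -> R}.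
Hypothesis hB : brownian_vector P B.
Local Notation integ := (integ P).
Local Notation Ex := (Ex P).
Local Notation incr := (incr B).
Local Notation past := (past B).
Local Notation step := (step B).
Local Notation m2 := (@normal_moment R 2).

Lemma integ_bounded (U f : Omega -> R) : measurable_fun setT U ->
  (exists M, forall w, `|U w| <= M) -> integ f -> integ (fun w => U w * f w).
Proof.
move=> mU [M UM] If; have mf := integ_meas _ _ If.
have M0 : 0 <= M by apply: le_trans (UM point).
apply: (integ_le _ _ (fun w => M * `|f w|)); first exact: measurable_funM.
  by move=> w; rewrite normrM ler_wpM2r.
by apply: integZ; apply: integrable_norm.
Qed.

Lemma coef_past (x : step) k s : lft x <= s -> meas_wrt (past k s) (coef x).
Proof.
by move=> xs; apply: meas_wrt_sub (coef_adapted x); exact: filtration_past.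
Qed.

Lemma coef_meas (x : step) : measurable_fun setT (coef x).
Proof.
apply: meas_wrt_measurable (coef_past x (dir x) (lft x) (lexx _)).
exact: past_measurable hB _ _.
Qed.

Lemma coefM_bounded (x y : step) : exists M, forall w, `|coef x w * coef y w| <= M.
Proof.
have [M hM] := coef_bounded x; have [N hN] := coef_bounded y.
by exists (M * N) => w; rewrite normrM ler_pM.
Qed.

Lemma integ_coefM (x y : step) : integ (fun w => coef x w * coef y w).
Proof.
apply: (@eq_integ _ _ _ _ (fun w => coef x w * coef y w * 1)) => [w|]; first by rewrite mulr1.
apply: integ_bounded (coefM_bounded x y) (integ_cst P 1).
by apply: measurable_funM; exact: coef_meas.
Qed.

Lemma integ_incrM j k s t u v : 0 <= s -> s <= t -> 0 <= u -> u <= v ->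
  integ (fun w => incr j s t w * incr k u v w).
Proof.
move=> s0 st u0 uv.
have t0 := le_trans s0 st; have v0 := le_trans u0 uv.
apply: (integ_le _ _ (fun w => incr j s t w ^+ 2 + incr k u v w ^+ 2)).
- by apply: measurable_funM; apply: (meas_incr hB).
- move=> w; rewrite ler_norml; move: (incr j s t w) (incr k u v w) => a b.
  by have := sqr_ge0 (a + b); have := sqr_ge0 (a - b); have := sqr_ge0 a;
    have := sqr_ge0 b; nra.
- by apply: integD; apply: (incr_integ hB).
Qed.

(** The isometry for one pair of terms.  Let x be the term that begins first.  In
different directions, everything but the increment of y belongs to the past of
that increment, whose mean is 0.  In the same direction the two increments are
cut at the ends of the common interval ]lft y, m], if there is one: the square of
the common increment D gives m2 (m - lft y), and every other product contains an
increment that is independent of, and later than, the remaining factors. *)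
Lemma step_pairing (x y : step) :
  integ (fun w => step_int x w * step_int y w) /\
  Ex (fun w => step_int x w * step_int y w) =
  (dir x == dir y)%:R * (m2 * Ex (fun w => coef x w * coef y w * overlap x y)).
Proof.
have sym : (lft x <= lft y) || (lft y <= lft x) by exact: le_total.
wlog xy : x y {sym} / lft x <= lft y.
  move=> W; case/orP: sym => [|yx]; first exact: W.
  have [I E] := W y x yx; split.
    by apply: eq_integ I => w; rewrite mulrC.
  rewrite (eq_Ex _ _ (fun w => step_int y w * step_int x w)); last by move=> w; rewrite mulrC.
  rewrite E eq_sym overlapC; congr (_ * (_ * _)).
  by apply: eq_Ex => w; rewrite (mulrC (coef y w)).
pose U w := coef x w * coef y w.
have mU k s : lft y <= s -> meas_wrt (past k s) U.
  by move=> ys; apply: meas_wrtM; apply: coef_past => //; exact: le_trans ys.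
have mU' : measurable_fun setT U by apply: measurable_funM; exact: coef_meas.
have bU : exists M, forall w, `|U w| <= M := coefM_bounded x y.
have IU : integ U := integ_coefM x y.
have x0 := lft_ge0 x; have y0 := lft_ge0 y.
have xr := lft_rgt x; have yr := lft_rgt y.
split.
  apply: eq_integ (integ_bounded _ _ mU' bU (integ_incrM (dir x) (dir y) _ _ _ _ x0 xr y0 yr)) => w.
  by rewrite /step_int /U mulrACA.
have mart W : meas_wrt (past (dir y) (lft y)) W -> integ W ->
    Ex (fun w => W w * incr (dir y) (lft y) (rgt y) w) = 0.
  by move=> mW IW; have [] := martingale_incr hB _ _ _ W y0 yr mW IW.
have xr0 : 0 <= rgt x by exact: le_trans xr.
have [dxy|dxy] := eqVneq (dir x) (dir y); last first.
  rewrite mul0r -[RHS](mart (fun w => U w * incr (dir x) (lft x) (rgt x) w)).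
  - by apply: eq_Ex => w; rewrite /step_int mulrACA mulrA.
  - apply: meas_wrtM; first exact: mU.
    by apply: past_incr => // /eqP; rewrite (negbTE dxy).
  - by apply: integ_bounded => //; apply: (incr_integ hB _ _ _ 1).
rewrite mul1r /step_int dxy; set k := dir y in mart *.
have [ry|yrx] := leP (rgt x) (lft y).
  have -> : overlap x y = 0.
    apply: max_l; rewrite subr_le0 (max_r xy).
    by rewrite ge_min ry.
  rewrite (eq_Ex _ (fun w => coef x w * coef y w * 0) (fun=> 0)) => [|w]; last by rewrite mulr0.
  rewrite Ex_cst mulr0.
  rewrite -[RHS](mart (fun w => U w * incr k (lft x) (rgt x) w)).
  - by apply: eq_Ex => w; rewrite mulrACA mulrA.
  - by apply: meas_wrtM; [exact: mU|apply: past_incr].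
  - by apply: integ_bounded => //; apply: (incr_integ hB _ _ _ 1).
pose m := Num.min (rgt x) (rgt y); pose M := Num.max (rgt x) (rgt y).
have ym : lft y <= m by rewrite le_min (ltW yrx).
have mM : m <= M by rewrite ge_min le_max lexx.
have m0 : 0 <= m by exact: le_trans ym.
have -> : overlap x y = m - lft y.
  by rewrite /overlap (max_r xy) -/m max_r// subr_ge0.
pose A := incr k (lft x) (lft y); pose D := incr k (lft y) m; pose N := incr k m M.
(* One of rgt x and rgt y is m and the other is M, so that no product of two
   increments over ]m, M] occurs. *)
rewrite (eq_Ex _ _ (fun w => U w * A w * incr k (lft y) (rgt y) w +
    (U w * D w ^+ 2 + U w * D w * N w))); last first.
  move=> w; rewrite /U /A /D /N /m /M /incr.
  by case: leP => _; ring.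
have ID : integ D by apply: (incr_integ hB _ _ _ 1).
have [I1 E1] : integ (fun w => U w * A w * incr k (lft y) (rgt y) w) /\
    Ex (fun w => U w * A w * incr k (lft y) (rgt y) w) = 0.
  apply: (martingale_incr hB) => //.
    by apply: meas_wrtM; [exact: mU|apply: past_incr].
  by apply: integ_bounded => //; apply: (incr_integ hB _ _ _ 1).
have [I2 E2] : integ (fun w => U w * D w * N w) /\ Ex (fun w => U w * D w * N w) = 0.
  apply: (martingale_incr hB) => //.
    by apply: meas_wrtM; [exact: mU|apply: past_incr].
  exact: integ_bounded.
have [I3 E3] : integ (fun w => U w * D w ^+ 2) /\
    Ex (fun w => U w * D w ^+ 2) = Ex U * (m2 * (m - lft y)).
  rewrite -(Ex_incr2 hB k _ _ y0 ym).
  apply: (indep_incr hB _ _ _ _ (fun z => z ^+ 2)) => //; first exact: mU.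
  - exact: (incr_integ hB).
rewrite ExD//; last exact: integD.
rewrite ExD// E1 E2 E3 add0r addr0 mulrCA; congr (_ * _).
rewrite mulrC -ExZ//; apply: eq_Ex => w; exact: mulrC.
Qed.

Lemma integ_steps_sqr (L : seq step) k : integ (steps_sqr L k).
Proof.
pose f (x y : step) w := coef x w * coef y w * overlap x y.
have If x y : integ (f x y).
  by apply: eq_integ (integZ _ (overlap x y) _ (integ_coefM x y)) => w; rewrite mulrC.
rewrite /steps_sqr; apply: (@eq_integ _ _ _ _ (fun w =>
    \sum_(x <- [seq x <- L | dir x == k]) \sum_(y <- [seq y <- L | dir y == k]) f x y w)).
  by move=> w; rewrite big_filter; apply: eq_bigr => x _; rewrite big_filter.
by apply: integ_sum => x; apply: integ_sum.
Qed.

(** Sum step_pairing over all pairs of terms. *)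
Lemma ito_isometry (L : seq step) :
  integ (fun w => steps_int L w ^+ 2) /\
  Ex (fun w => steps_int L w ^+ 2) = m2 * \sum_k Ex (steps_sqr L k).
Proof.
pose g (x y : step) w := step_int x w * step_int y w.
have Ig x y : integ (g x y) by have [] := step_pairing x y.
pose f (x y : step) w := coef x w * coef y w * overlap x y.
have If x y : integ (f x y).
  by apply: eq_integ (integZ _ (overlap x y) _ (integ_coefM x y)) => w; rewrite mulrC.
have E w : \sum_(x <- L) \sum_(y <- L) g x y w = steps_int L w ^+ 2.
  by rewrite expr2 /steps_int big_distrlr.
split; first by apply: eq_integ E _; apply: integ_sum => x; exact: integ_sum.
rewrite -(eq_Ex _ _ _ E) Ex_sum; last by move=> x; exact: integ_sum.
under eq_bigr do rewrite Ex_sum//.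
transitivity (\sum_(x <- L) \sum_(y <- L) (dir x == dir y)%:R * (m2 * Ex (f x y))).
  by apply: eq_bigr => x _; apply: eq_bigr => y _; have [_] := step_pairing x y.
have -> : \sum_k Ex (steps_sqr L k) = \sum_(k < d) \sum_(x <- L) \sum_(y <- L)
    ((dir x == k) && (dir y == k))%:R * Ex (f x y).
  apply: eq_bigr => k _; rewrite (eq_Ex _ _ (fun w => \sum_(x <- L) \sum_(y <- L)
      ((dir x == k) && (dir y == k))%:R * f x y w)).
    rewrite Ex_sum; last by move=> x; apply: integ_sum => y; apply: integZ.
    apply: eq_bigr => x _; rewrite Ex_sum; last by move=> y; apply: integZ.
    by apply: eq_bigr => y _; rewrite ExZ.
  move=> w; rewrite /steps_sqr big_mkcond; apply: eq_bigr => x _.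
  case: eqP => _; last by rewrite big1// => y _; rewrite mul0r.
  by rewrite big_mkcond; apply: eq_bigr => y _; case: eqP => _ /=; rewrite ?mul1r ?mul0r.
rewrite [in RHS]exchange_big mulr_sumr; apply: eq_bigr => x _ /=.
rewrite exchange_big mulr_sumr; apply: eq_bigr => y _ /=.
rewrite -mulr_suml mulrCA; congr (_ * (_ * _)).
rewrite (bigD1 (dir x))//= eqxx/= big1 ?addr0; first by rewrite eq_sym.
by move=> k /negbTE; rewrite eq_sym => ->.
Qed.

End isometry.

(** * Second moments and convergence to 0 *)

Section second_moment.
Context {R : realType} {d' : measure_display} {Omega : measurableType d'}.
Variable P : probability Omega R.
Implicit Types f g h : Omega -> R.

(** Extended-real, so that the inequalities below hold without any integrability
assumption. *)
Definition mean_sqr f : \bar R := (\int[P]_w (f w ^+ 2)%:E)%E.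

Lemma mean_sqr_ge0 f : (0 <= mean_sqr f)%E.
Proof. by apply: integral_ge0 => w _; rewrite lee_fin sqr_ge0. Qed.

Lemma eq_mean_sqr f g : f =1 g -> mean_sqr f = mean_sqr g.
Proof. by move=> /funext ->. Qed.

Lemma mean_sqr_Ex f : integ P (fun w => f w ^+ 2) -> mean_sqr f = (Ex P (fun w => f w ^+ 2))%:E.
Proof. exact: ExE. Qed.

Let msqr f : measurable_fun setT f -> measurable_fun setT (fun w => (f w ^+ 2)%:E).
Proof. by move=> mf; apply/measurable_EFinP; exact: measurable_funX. Qed.

Lemma mean_sqr_le2 h f g : measurable_fun setT h -> measurable_fun setT f ->
    measurable_fun setT g ->
  (forall w, h w = f w + g w) -> (mean_sqr h <= 2%:E * mean_sqr f + 2%:E * mean_sqr g)%E.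
Proof.
move=> mh mf mg hfg; rewrite /mean_sqr -!ge0_integralZl//; try exact: msqr; last 2 first.
  by move=> w _; rewrite lee_fin sqr_ge0.
  by move=> w _; rewrite lee_fin sqr_ge0.
rewrite -ge0_integralD//; last 4 first.
  by move=> w _; rewrite -EFinM lee_fin mulr_ge0// sqr_ge0.
  by apply: emeasurable_funM => //; exact: msqr.
  by move=> w _; rewrite -EFinM lee_fin mulr_ge0// sqr_ge0.
  by apply: emeasurable_funM => //; exact: msqr.
apply: ge0_le_integral => //; first by move=> w _; rewrite lee_fin sqr_ge0.
- exact: msqr.
- by apply: emeasurable_funD; apply: emeasurable_funM => //; exact: msqr.
- move=> w _; rewrite -!EFinM -EFinD lee_fin hfg.
  by have := sqr_ge0 (f w - g w); nra.
Qed.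

Lemma mean_sqr_le2_fin h f g a b : measurable_fun setT h -> measurable_fun setT f ->
    measurable_fun setT g -> (forall w, h w = f w + g w) ->
  (mean_sqr f <= a%:E)%E -> (mean_sqr g <= b%:E)%E -> (mean_sqr h <= (2 * a + 2 * b)%:E)%E.
Proof.
move=> mh mf mg hfg fa gb; apply: le_trans (mean_sqr_le2 _ _ _ mh mf mg hfg) _.
by rewrite (EFinD (2 * a) (2 * b)) (EFinM 2 a) (EFinM 2 b) leeD// lee_wpmul2l// lee_fin.
Qed.

Lemma mean_sqr_opp f g : (forall w, f w = - g w) -> mean_sqr f = mean_sqr g.
Proof. by move=> fg; apply: eq_integral => w _; rewrite fg sqrrN. Qed.

End second_moment.

Lemma cvg0e_near (R : realType) (T : Type) (F : set_system T) (u : T -> \bar R) (e : R) :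
  u @ F --> 0%E -> 0 < e -> \forall x \near F, (u x < e%:E)%E.
Proof.
move=> u0 e0; suff /u0 : nbhs (0 : \bar R)%E [set y | y < e%:E]%E by [].
by apply: open_nbhs_nbhs; split; [exact: open_ereal_lt_ereal|rewrite /= lte_fin].
Qed.

Lemma near_cvg0e (R : realType) (T : Type) (F : set_system T) (FF : Filter F)
    (u : T -> \bar R) :
  (\forall x \near F, 0 <= u x)%E ->
  (forall e : R, 0 < e -> \forall x \near F, (u x <= e%:E)%E) -> u @ F --> 0%E.
Proof.
move=> u0 h; apply/fine_cvgP; split.
  near=> x; rewrite ge0_fin_numE; last by near: x.
  by apply: (@le_lt_trans _ _ 1%:E); [near: x; exact: h|exact: ltry].
apply/cvgrPdist_le => e e0; near=> x.
have ux0 : (0 <= u x)%E by near: x.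
have uxe : (u x <= e%:E)%E by near: x; exact: h.
rewrite sub0r normrN ger0_norm ?fine_ge0//.
by rewrite -lee_fin fineK// ge0_fin_numE// (le_lt_trans uxe)// ltry.
Unshelve. all: by end_near. Qed.

(** * Deterministic step functions *)

Section deterministic_steps.
Context {R : realType} {d' : measure_display} {Omega : measurableType d'}.
Context {d : nat} (B : 'I_d -> R -> Omega -> R).
Local Notation step := (step B).
Implicit Types (x : step) (L : seq step).

(** Combinations of the values B k u, counted from time 0: B k 0 vanishes only
almost surely, and with increments from 0 all identities hold pointwise. *)
Definition lin_comb (l : seq ('I_d * R * R)) (w : Omega) :=
  \sum_(p <- l) p.2 * incr B p.1.1 0 p.1.2 w.

Definition gauss_span (f : Omega -> R) :=
  exists l, all (fun p => 0 <= p.1.2) l /\ forall w, f w = lin_comb l w.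

Lemma gauss_spanD f g h : gauss_span f -> gauss_span g ->
  (forall w, h w = f w + g w) -> gauss_span h.
Proof.
move=> [l [l0 fE]] [l' [l'0 gE]] hE; exists (l ++ l').
by rewrite all_cat l0 l'0; split => // w; rewrite hE fE gE /lin_comb big_cat.
Qed.

Lemma gauss_spanZ (c : R) f h : gauss_span f -> (forall w, h w = c * f w) ->
  gauss_span h.
Proof.
move=> [l [l0 fE]] hE; exists [seq (p.1, c * p.2) | p <- l]; split.
  by rewrite all_map.
move=> w; rewrite hE fE /lin_comb big_map mulr_sumr; apply: eq_bigr => p _ /=.
by rewrite mulrA.
Qed.

Lemma gauss_span0 : gauss_span (fun=> 0).
Proof. by exists [::]; split => // w; rewrite /lin_comb big_nil. Qed.

Lemma gauss_span_incr k t : 0 <= t -> gauss_span (incr B k 0 t).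
Proof.
move=> t0; exists [:: (k, t, 1)]; rewrite /= t0; split => // w.
by rewrite /lin_comb big_seq1 mul1r.
Qed.

Lemma det_adapted s (c : R) : meas_wrt (natural_filtration B s) (fun=> c).
Proof. exact: meas_wrt_cst. Qed.

Lemma det_bounded (c : R) : exists M, forall w : Omega, `|c| <= M.
Proof. by exists `|c|. Qed.

Definition det_step k (a b c : R) (a0 : 0 <= a) (ab : a <= b) : step :=
  Step B k a b (fun=> c) a0 ab (det_adapted a c) (det_bounded c).

(** L is a deterministic step function in the direction k that is uniformly e-close
to g on ]0, t]; the last clause records that its coefficients are constants. *)
Record det_approx (k : 'I_d) (t e : R) (g : R -> R) (L : seq step) : Prop :=
  DetApprox {
  det_dir : forall j s w, j != k -> steps_val L j s w = 0;
  det_supp : forall j s w, ~~ (0 < s <= t) -> steps_val L j s w = 0;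
  det_close : forall s w, 0 < s <= t -> `|steps_val L k s w - g s| <= e;
  det_span : gauss_span (steps_int L) }.

Lemma steps_val_cons x L j s w : steps_val (x :: L) j s w =
  (if dir x == j then coef x w * \1_(`]lft x, rgt x]) s else 0) + steps_val L j s w.
Proof. by rewrite /steps_val big_cons; case: ifP => //; rewrite add0r. Qed.

Lemma det_approx0 k e g : det_approx k 0 e g [::].
Proof.
split.
- by move=> *; rewrite /steps_val big_nil.
- by move=> *; rewrite /steps_val big_nil.
- by move=> s w /andP[s0 s0']; have := lt_le_trans s0 s0'; rewrite ltxx.
- have -> : steps_int (B := B) [::] = fun=> 0.
    by apply/funext => w; rewrite /steps_int big_nil.
  exact: gauss_span0.
Qed.

Lemma det_approx_cons k t u e g L c (t0 : 0 <= t) (tu : t <= u) :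
  det_approx k t e g L -> (forall s, t < s <= u -> `|c - g s| <= e) ->
  det_approx k u e g (det_step k t u c t0 tu :: L).
Proof.
move=> [dirL suppL closeL spanL] cg; split.
- by move=> j s w jk; rewrite steps_val_cons dirL// addr0 eq_sym (negbTE jk).
- move=> j s w su; rewrite steps_val_cons suppL; last first.
    by apply: contra su => /andP[-> st]/=; exact: le_trans tu.
  case: ifP => _; rewrite ?addr0//= indicE memNset ?mulr0//= in_itv/=.
  by apply/negP; apply: contra su => /andP[/(le_lt_trans t0) -> ->].
- move=> s w /andP[s0 su]; rewrite steps_val_cons/= eqxx.
  have [st|ts] := leP s t.
    rewrite indicE memNset ?mulr0 ?add0r; first by apply: closeL; rewrite s0.
    by rewrite /= in_itv/= ltNge st.
  rewrite suppL; last by rewrite (leNgt s) ts andbF.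
  rewrite addr0 indicE mem_set ?mulr1; first by apply: cg; rewrite ts.
  by rewrite /= in_itv/= ts.
- have ID : gauss_span (fun w => incr B k 0 u w + (-1) * incr B k 0 t w).
    apply: gauss_spanD (gauss_span_incr k u (le_trans t0 tu)) _ (fun=> erefl).
    by apply: gauss_spanZ (gauss_span_incr k t t0) (fun=> erefl).
  apply: gauss_spanD (gauss_spanZ c _ _ ID (fun=> erefl)) spanL _ => w.
  by rewrite /steps_int big_cons /step_int/= /incr; congr (_ + _); ring.
Qed.

(** Let z be the supremum of the x <= t up to which an approximation exists.  Near z
the function g is within e of g z, so that an approximation up to some point
just below z extends, by one more step of height g z, to min(t, z + r/2).
Therefore z = t. *)
Lemma det_approx_exists k t e (g : R -> R) : 0 <= t -> 0 < e ->
  {within `[0, t], continuous g} -> exists L, det_approx k t e g L.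
Proof.
move=> t0 e0 cg.
pose A := [set x | 0 <= x <= t /\ exists L, det_approx k x e g L].
have A0 : A 0 by rewrite /A /= lexx t0; split => //; exists [::]; exact: det_approx0.
have ubA : ubound A t by move=> x [/andP[]].
have hsA : has_sup A by split; [exists 0|exists t].
pose z := sup A.
have z0 : 0 <= z by apply: ub_le_sup => //; exact: hsA.2.
have zt : z <= t by apply: ge_sup => //; exists 0.
have zI : `[0, t]%classic z by rewrite /= in_itv/= z0.
have : within `[0, t] (nbhs z) (fun s => `|g z - g s| < e).
  rewrite (nbhs_subspace_in zI).
  by have /cvgrPdist_lt := cg z; apply.
move=> /nbhs_ballP[r /= r0 hr].
have close s : 0 <= s <= t -> `|z - s| < r -> `|g z - g s| <= e.
  by move=> st zs; apply/ltW/hr => //=; rewrite in_itv.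
have [x Ax zrx] : exists2 x, A x & z - r < x.
  by apply: sup_adherent hsA.
have xz : x <= z by apply: ub_le_sup => //; exact: hsA.2.
have [/andP[x0 xt] [L HL]] := Ax.
pose y := Num.min t (z + r / 2).
have r2 : 0 < r / 2 by rewrite divr_gt0.
have zy : z <= y by rewrite le_min zt lerDl ltW.
have xy : x <= y := le_trans xz zy.
have Hy : det_approx k y e g (det_step k x y (g z) x0 xy :: L).
  apply: det_approx_cons HL _ => s /andP[xs]; rewrite le_min => /andP[st szr].
  apply: close; first by rewrite st (le_trans x0)// ltW.
  by rewrite ltr_norml; apply/andP; split; lra.
have Ay : A y.
  split; first by rewrite (le_trans x0 xy) ge_min lexx.
  by eexists; exact: Hy.
have yz : y <= z by apply: ub_le_sup => //; exact: hsA.2.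
have -> : t = y.
  by move: yz; rewrite /y; case: (leP t) => // _; rewrite gerDl leNgt r2.
by case: Ay.
Qed.

End deterministic_steps.

(** * Approximation of Ito integrals by deterministic steps *)

Section ito_approx.
Context {R : realType} {d' : measure_display} {Omega : measurableType d'}.
Context {P : probability Omega R} {d : nat} {B : 'I_d -> R -> Omega -> R}.
Hypothesis hB : brownian_vector P B.
Local Notation m2 := (@normal_moment R 2).
Local Notation step := (step B).
Local Notation F := (natural_filtration B).
Local Notation mu := (@lebesgue_measure R).
Implicit Types (x : step) (L : seq step).

Definition simple_step (t : R) (S : simple_process F t) (k : 'I_d) (i : 'I_(sp_size S)) : step.
Proof.
refine (@Step _ _ _ _ B k (sp_time S i) (sp_time S i.+1) (sp_coef S i) _ _ _ _).
- exact: le_trans (@sp_time_ge0 _ _ _ _ S) (@sp_time_homo _ _ _ _ S _ _ (leq0n i)).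
- exact: (@sp_time_homo _ _ _ _ S).
- by move=> C mC; apply: sp_coef_adapted.
- by have [M hM] := sp_coef_bounded S; exists M => w; exact: hM.
Defined.

Definition simple_steps (t : R) (S : simple_process F t) k : seq step :=
  [seq simple_step t S k i | i <- index_enum 'I_(sp_size S)].

Lemma simple_steps_int t (S : simple_process F t) k w :
  steps_int (simple_steps t S k) w = sp_integral S (B k) w.
Proof. by rewrite /steps_int big_map. Qed.

Lemma simple_steps_val t (S : simple_process F t) k s w :
  steps_val (simple_steps t S k) k s w = sp_val S s w.
Proof. by rewrite /steps_val big_map; apply: eq_bigl => i /=; rewrite eqxx. Qed.

Lemma simple_steps_dir t (S : simple_process F t) k j s w : j != k ->
  steps_val (simple_steps t S k) j s w = 0.
Proof.
move=> jk; rewrite /steps_val big_map big1// => i /=.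
by rewrite eq_sym (negbTE jk).
Qed.

Lemma simple_steps_supp t (S : simple_process F t) k j s w : ~~ (0 < s <= t) ->
  steps_val (simple_steps t S k) j s w = 0.
Proof.
move=> st; rewrite /steps_val big_map big1// => i _ /=.
rewrite indicE memNset ?mulr0//= in_itv/=; apply/negP; apply: contra st.
move=> /andP[s1 s2]; apply/andP; split.
  apply: le_lt_trans s1.
  exact: le_trans (@sp_time_ge0 _ _ _ _ S) (@sp_time_homo _ _ _ _ S _ _ (leq0n i)).
by apply: (le_trans s2); apply: le_trans (@sp_time_le _ _ _ _ S); exact: (@sp_time_homo _ _ _ _ S).
Qed.

Definition neg_step (x : step) : step.
Proof.
refine (@Step _ _ _ _ B (dir x) (lft x) (rgt x) (fun w => -1 * coef x w)
  (lft_ge0 x) (lft_rgt x) _ _).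
- by apply: meas_wrtM; [exact: meas_wrt_cst|exact: coef_adapted].
- by have [M hM] := coef_bounded x; exists M => w; rewrite mulN1r normrN.
Defined.

Lemma neg_steps_int L w : steps_int (map neg_step L) w = - steps_int L w.
Proof.
rewrite /steps_int big_map -sumrN; apply: eq_bigr => x _.
by rewrite /step_int/= mulN1r mulNr.
Qed.

Lemma neg_steps_val L k s w : steps_val (map neg_step L) k s w = - steps_val L k s w.
Proof.
rewrite /steps_val big_map -sumrN; apply: eq_bigr => x _.
by rewrite /= mulN1r mulNr.
Qed.

Lemma cat_steps_int L L' w : steps_int (L ++ L') w = steps_int L w + steps_int L' w.
Proof. by rewrite /steps_int big_cat. Qed.

Lemma cat_steps_val L L' k s w :
  steps_val (L ++ L') k s w = steps_val L k s w + steps_val L' k s w.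
Proof. by rewrite /steps_val big_cat. Qed.

Lemma steps_int_meas L : measurable_fun setT (steps_int L).
Proof.
apply: measurable_sum => x; apply: measurable_funM.
  exact: (coef_meas hB).
apply: (meas_incr hB); first exact: lft_ge0.
exact: le_trans (lft_ge0 x) (lft_rgt x).
Qed.

Lemma steps_sqr_ge0 L k w : 0 <= steps_sqr L k w.
Proof.
rewrite -lee_fin -steps_sqrE; apply: integral_ge0 => s _.
by rewrite lee_fin sqr_ge0.
Qed.

Lemma steps_sqr_eq0 L k w : (forall s, steps_val L k s w = 0) -> steps_sqr L k w = 0.
Proof.
move=> L0; apply: EFin_inj; rewrite -steps_sqrE integral0_eq// => s _.
by rewrite L0 expr0n.
Qed.

Lemma measurable_joint_val L k :
  measurable_fun setT (fun z : Omega * R => steps_val L k z.2 z.1).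
Proof.
rewrite (_ : (fun z => _) = fun z : Omega * R => \sum_(x <- [seq x <- L | dir x == k])
    coef x z.1 * \1_(`]lft x, rgt x]) z.2); last first.
  by apply/funext => z; rewrite big_filter.
apply: measurable_sum => x; apply: measurable_funM.
  by apply: measurableT_comp => //; exact: (coef_meas hB).
have mI : measurable_fun setT (\1_(`]lft x, rgt x]) : R -> R) by exact: measurable_indic.
exact: (measurableT_comp mI measurable_snd).
Qed.

Section error.
Variables (k : 'I_d) (t e : R) (g : R -> R) (L : seq step).
Hypotheses (t0 : 0 <= t) (e0 : 0 <= e) (cg : {within `[0, t], continuous g}).
Hypothesis HL : det_approx B k t e g L.

Let mg : measurable_fun `[0, t] g.
Proof. by apply: subspace_continuous_measurable_fun. Qed.

Let phi (S : simple_process F t) w : \bar R :=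
  (\int[mu]_(s in `[0%R, t]) ((sp_val S s w - g s)%R ^+ 2)%:E)%E.

Let measurable_phi S : measurable_fun setT (phi S).
Proof.
pose f (z : Omega * R) : \bar R :=
  ((steps_val (simple_steps t S k) k z.2 z.1 - (g \_ `[0, t]) z.2) ^+ 2 *
  \1_(`[0, t]) z.2)%:E.
have mf : measurable_fun setT f.
  apply/measurable_EFinP; apply: measurable_funM.
    apply: measurable_funX; apply: measurable_funB; first exact: measurable_joint_val.
    have mgr : measurable_fun setT (g \_ `[0, t]) by exact/(measurable_restrictT _ _).1.
    exact: (measurableT_comp mgr measurable_snd).
  have mI : measurable_fun setT (\1_(`[0, t]) : R -> R) by exact: measurable_indic.
  exact: (measurableT_comp mI measurable_snd).
have f0 z : (0 <= f z)%E by rewrite lee_fin mulr_ge0// sqr_ge0.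
have := @measurable_fun_fubini_tonelli_F _ _ _ _ R mu f mf f0.
rewrite (_ : fubini_F mu f = phi S)//.
apply/funext => w; rewrite /fubini_F /phi [RHS]integral_mkcond.
apply: eq_integral => s _; rewrite /f/= simple_steps_val !patchE indicE.
by case: ifPn => _; rewrite ?mulr1 ?mulr0.
Qed.

(** The difference of the two integrals is the integral of one sequence of steps;
by the isometry its second moment is m2 times that of the integrand
S - L = (S - g) + (g - L). *)
Lemma simple_det_error (S : simple_process F t) :
  (mean_sqr P (fun w => sp_integral S (B k) w - steps_int L w)%R <=
   m2%:E * (2%:E * \int[P]_w phi S w + (2 * (t * e ^+ 2))%:E))%E.
Proof.
pose D := simple_steps t S k ++ map neg_step L.
have Dval j s w : steps_val D j s w =
    steps_val (simple_steps t S k) j s w - steps_val L j s w.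
  by rewrite cat_steps_val neg_steps_val.
have [ID ED] := ito_isometry hB D.
have m20 : 0 <= m2 by exact/ltW/normal_moment2_gt0.
rewrite (@eq_mean_sqr _ _ _ _ _ (steps_int D)); last first.
  by move=> w; rewrite cat_steps_int simple_steps_int neg_steps_int.
rewrite mean_sqr_Ex// ED (bigD1 k)//= big1 ?addr0; last first.
  move=> j jk; rewrite (eq_Ex _ _ (fun=> 0)) ?Ex_cst// => w.
  apply: steps_sqr_eq0 => s; rewrite Dval simple_steps_dir// (det_dir _ _ _ _ _ _ HL)//.
  by rewrite subrr.
rewrite EFinM lee_wpmul2l ?lee_fin// -ExE; last exact: (integ_steps_sqr hB).
have phi0 w : (0 <= phi S w)%E.
  by apply: integral_ge0 => s _; rewrite lee_fin sqr_ge0.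
apply: (@le_trans _ _ (\int[P]_w (2%:E * phi S w + (2 * (t * e ^+ 2))%:E))%E); last first.
  rewrite ge0_integralD//; last 3 first.
  - by move=> w _; rewrite mule_ge0.
  - exact: emeasurable_funM.
  - by move=> w _; rewrite lee_fin !mulr_ge0// sqr_ge0.
  rewrite ge0_integralZl// integral_cst//.
  by have := @probability_setT _ _ _ P => /= ->; rewrite mule1.
apply: ge0_le_integral => //.
- by move=> w _; rewrite lee_fin steps_sqr_ge0.
- by apply/measurable_EFinP; apply: integ_meas (integ_steps_sqr hB _ _).
- by apply: emeasurable_funD => //; exact: emeasurable_funM.
move=> w _; rewrite -steps_sqrE.
have mS : measurable_fun setT (fun s => sp_val S s w).
  by apply: measurable_sum => i; apply: measurable_funM => //; exact: measurable_indic.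
rewrite (_ : (\int[mu]_s _ =
    \int[mu]_(s in `[0%R, t]) ((steps_val D k s w) ^+ 2)%:E)%E); last first.
  rewrite [RHS]integral_mkcond; apply: eq_integral => s _; rewrite patchE.
  case: ifPn => //; rewrite notin_setE/= in_itv/= => /negP st.
  have st' : ~~ (0 < s <= t) by apply: contra st => /andP[/ltW -> ->].
  by rewrite Dval simple_steps_supp// (det_supp _ _ _ _ _ _ HL)// subrr expr0n.
have mSg : measurable_fun `[0%R, t] (fun s => ((sp_val S s w - g s)%R ^+ 2)%:E).
  apply/measurable_EFinP; apply: measurable_funX; apply: measurable_funB => //.
  exact: measurable_funTS.
have mD : measurable_fun setT (fun s => steps_val D k s w).
  have := @measurable_pair1 _ _ Omega R w.
  have mj := measurable_joint_val D k.
  move=> mp; exact: (measurableT_comp mj mp).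
apply: (@le_trans _ _ (\int[mu]_(s in `[0%R, t])
    (2%:E * ((sp_val S s w - g s)%R ^+ 2)%:E + (2 * e ^+ 2)%:E))%E).
  apply: ge0_le_integral => //=.
  - by move=> s _; rewrite lee_fin sqr_ge0.
  - apply/measurable_EFinP/measurable_funX.
    exact: measurable_funTS.
  - by apply: emeasurable_funD => //; exact: emeasurable_funM.
  move=> s; rewrite in_itv/= => /andP[s0 st]; rewrite -EFinM -EFinD lee_fin.
  rewrite Dval simple_steps_val.
  have [s00|s00] := eqVneq s 0.
    have st' : ~~ (0 < s <= t) by rewrite s00 ltxx.
    rewrite -(simple_steps_val t S k) simple_steps_supp// (det_supp _ _ _ _ _ _ HL)//.
    rewrite subrr expr0n/=.
    by rewrite addr_ge0// mulr_ge0// sqr_ge0.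
  have sgt0 : 0 < s by rewrite lt_def s00.
  have := det_close _ _ _ _ _ _ HL s w; rewrite sgt0 st => /(_ isT).
  rewrite ler_norml => /andP[]; move: (sp_val S s w) (steps_val L k s w) (g s) => a b c h1 h2.
  have : (c - b) ^+ 2 <= e ^+ 2 by nra.
  by have := sqr_ge0 (a - c - (c - b)); nra.
rewrite ge0_integralD//=; last 3 first.
- by move=> s _; rewrite -EFinM lee_fin mulr_ge0// sqr_ge0.
- exact: emeasurable_funM.
- by move=> s _; rewrite lee_fin mulr_ge0// sqr_ge0.
rewrite ge0_integralZl//; last by move=> s _; rewrite lee_fin sqr_ge0.
rewrite integral_cst//= lebesgue_measure_itv/= lte_fin leeD//.
case: ifPn => _; last by rewrite mule0 lee_fin !mulr_ge0 ?sqr_ge0.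
by rewrite -EFinD -EFinM lee_fin oppr0 addr0 -mulrA (mulrC t).
Qed.

(** The bound depends neither on Y nor on the processes that define it, so that it
yields uniqueness of the integral as well as its approximation by elements of
gauss_span B. *)
Lemma ito_approx (Y : Omega -> R) :
  is_ito_integral P F (B k) (fun s _ => g s) t Y ->
  (mean_sqr P (fun w => Y w - steps_int L w)%R <= (4 * m2 * (t * e ^+ 2))%:E)%E.
Proof.
move=> [mY [S [Sg SY]]]; apply/lee_addgt0Pr => r r0.
have m20 : 0 < m2 by exact: normal_moment2_gt0.
(* Chosen so that 2 c + 2 m2 (2 c) = r. *)
pose c := r / (2 + 4 * m2).
have cden : 0 < 2 + 4 * m2 by rewrite addr_gt0// mulr_gt0.
have c0 : 0 < c by rewrite divr_gt0.
have := filterI (cvg0e_near _ _ _ _ _ Sg c0) (cvg0e_near _ _ _ _ _ SY c0).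
move=> [n _ /(_ n (leqnn n)) [/= /ltW h1 /ltW h2]].
have mS : measurable_fun setT (sp_integral (S n) (B k)).
  by rewrite -(funext (simple_steps_int _ (S n) k)); exact: steps_int_meas.
have mL := steps_int_meas L.
have h3 : (mean_sqr P (fun w => sp_integral (S n) (B k) w - steps_int L w)%R <=
    (m2 * (2 * c + 2 * (t * e ^+ 2)))%:E)%E.
  apply: le_trans (simple_det_error (S n)) _.
  rewrite [leRHS]EFinM lee_wpmul2l ?lee_fin ?(ltW m20)//.
  by rewrite (EFinD (2 * c)) (EFinM 2 c) leeD// lee_wpmul2l.
have h4 : (mean_sqr P (fun w => Y w - sp_integral (S n) (B k) w)%R <= c%:E)%E.
  rewrite (@mean_sqr_opp _ _ _ _ _ (fun w => sp_integral (S n) (B k) w - Y w))//.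
  by move=> w; rewrite opprB.
have := mean_sqr_le2_fin P (fun w => Y w - steps_int L w)%R _ _ _ _ _ _ _ _ h4 h3.
move=> /(_ _ _ _ _) h5; apply: (le_trans (h5 _ _ _ _)).
- exact: measurable_funB.
- exact: measurable_funB.
- exact: measurable_funB.
- by move=> w; ring.
rewrite -EFinD lee_fin.
have -> : r = c * (2 + 4 * m2) by rewrite /c divfK// gt_eqF.
lra.
Qed.

End error.
End ito_approx.

(** * The fourth moment of linear combinations of increments *)

Section fourth_moment.
Context {R : realType} {d' : measure_display} {Omega : measurableType d'}.
Context {P : probability Omega R} {d : nat} {B : 'I_d -> R -> Omega -> R}.
Hypothesis hB : brownian_vector P B.
Local Notation m2 := (@normal_moment R 2).
Local Notation m4 := (@normal_moment R 4).
Local Notation integ := (integ P).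
Local Notation Ex := (Ex P).
Local Notation incr := (incr B).
Local Notation past := (past B).

(** The summand 3 absorbs the cross term 6 E W^2 E xi^2 of the fourth moment of
W + xi, and m4 / m2^2 the fourth moment of xi. *)
Definition kurtosis_bound : R := 3 + m4 / m2 ^+ 2.

Definition kurtosis_le f :=
  [/\ L4 P f, Ex f = 0 & Ex (fun w => f w ^+ 4) <= kurtosis_bound * Ex (fun w => f w ^+ 2) ^+ 2].

Lemma kurtosis_le0 : kurtosis_le (fun=> 0).
Proof.
split; [exact: L4_cst|exact: Ex_cst|].
by rewrite !expr0n/= !Ex_cst expr0n mulr0.
Qed.

(** Expanding the fourth power, independence and E W = E xi = 0 leave
E W^4 + 6 E W^2 E (b xi)^2 + E (b xi)^4, which is at most
C (E W^2 + E (b xi)^2)^2. *)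
Lemma kurtosis_le_incr k s t W b : 0 <= s -> s <= t -> meas_wrt (past k s) W ->
  kurtosis_le W -> kurtosis_le (fun w => W w + b * incr k s t w).
Proof.
move=> s0 st mW [LW EW W4].
pose xi := incr k s t.
have Lxi : L4 P xi := incr_L4 hB k s t s0 st.
have Ixi j : (j <= 4)%N -> integ (fun w => xi w ^+ j) by exact: L4_pow.
have IW j : (j <= 4)%N -> integ (fun w => W w ^+ j) by exact: L4_pow.
have mWj j : meas_wrt (past k s) (fun w => W w ^+ j).
  elim: j => [|j IH]; first by under eq_fun do rewrite expr0; exact: meas_wrt_cst.
  by under eq_fun do rewrite exprS; exact: meas_wrtM.
have cross i j : (i <= 4)%N -> (j <= 4)%N ->
    integ (fun w => W w ^+ i * xi w ^+ j) /\
    Ex (fun w => W w ^+ i * xi w ^+ j) = Ex (fun w => W w ^+ i) * Ex (fun w => xi w ^+ j).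
  move=> i4 j4; apply: (indep_incr hB k s t _ (fun z => z ^+ j)) => //.
  - exact: IW.
  - exact: Ixi.
have E1 : Ex (fun w => W w ^+ 1) = 0 by exact: EW.
have F1 : Ex (fun w => xi w ^+ 1) = 0 by exact: (Ex_incr hB).
have F2 := Ex_incr2 hB k s t s0 st; have F4 := Ex_incr4 hB k s t s0 st.
rewrite -/xi in F2 F4.
have m20 : 0 < m2 by exact: normal_moment2_gt0.
have LS : L4 P (fun w => W w + b * xi w) by apply: L4D => //; exact: L4Z.
split => //.
  rewrite ExD; [|exact: (IW 1)|exact: (integZ _ _ _ (Ixi 1%N isT))].
  by rewrite EW ExZ; [rewrite (Ex_incr hB)// mulr0 addr0|exact: (Ixi 1)].
have -> : Ex (fun w => (W w + b * xi w) ^+ 2) =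
    Ex (fun w => W w ^+ 2) + b ^+ 2 * (m2 * (t - s)).
  rewrite (eq_Ex _ _ (fun w => W w ^+ 2 + (2 * b * (W w ^+ 1 * xi w ^+ 1) + b ^+ 2 * xi w ^+ 2))).
    have [I11 E11] := cross 1 1 isT isT.
    rewrite ExD ?ExD ?ExZ ?E11 ?E1 ?F2 ?mul0r ?mulr0 ?add0r//.
    - exact: Ixi.
    - exact: integZ.
    - by apply: integZ; exact: Ixi.
    - exact: IW.
    - by apply: integD; apply: integZ => //; exact: Ixi.
  by move=> w; ring.
have -> : Ex (fun w => (W w + b * xi w) ^+ 4) = Ex (fun w => W w ^+ 4) +
    (6 * b ^+ 2 * (Ex (fun w => W w ^+ 2) * (m2 * (t - s))) +
     b ^+ 4 * (m4 * (t - s) ^+ 2)).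
  rewrite (eq_Ex _ _ (fun w => W w ^+ 4 + (4 * b * (W w ^+ 3 * xi w ^+ 1) +
     (4 * b ^+ 3 * (W w ^+ 1 * xi w ^+ 3) + (6 * b ^+ 2 * (W w ^+ 2 * xi w ^+ 2) +
      b ^+ 4 * xi w ^+ 4))))); last by move=> w; ring.
  have [I31 E31] := cross 3 1 isT isT; have [I13 E13] := cross 1 3 isT isT.
  have [I22 E22] := cross 2 2 isT isT.
  have J4 := integZ P (b ^+ 4) _ (Ixi 4 isT).
  have J22 := integD _ _ _ (integZ P (6 * b ^+ 2) _ I22) J4.
  have J13 := integD _ _ _ (integZ P (4 * b ^+ 3) _ I13) J22.
  have J31 := integD _ _ _ (integZ P (4 * b) _ I31) J13.
  rewrite ExD//; last exact: (IW 4).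
  rewrite ExD//; last exact: integZ.
  rewrite ExD//; last exact: integZ.
  rewrite ExD//; last exact: integZ.
  rewrite ExZ// ExZ// ExZ// ExZ; last exact: (Ixi 4).
  by rewrite E31 E13 E22 F1 E1 F2 F4 mul0r !mulr0 !add0r.
move: W4; have := Ex_ge0 P (fun w => W w ^+ 2) (fun w => sqr_ge0 _).
move: (Ex (fun w => W w ^+ 4)) (Ex (fun w => W w ^+ 2)) => A4 A A0 W4.
pose x := b ^+ 2 * (m2 * (t - s)).
have x0 : 0 <= x by rewrite mulr_ge0 ?sqr_ge0// mulr_ge0 ?subr_ge0// ltW.
have -> : 6 * b ^+ 2 * (A * (m2 * (t - s))) + b ^+ 4 * (m4 * (t - s) ^+ 2) =
    6 * (A * x) + m4 / m2 ^+ 2 * x ^+ 2.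
  by rewrite /x; field; rewrite gt_eqF.
rewrite -/x /kurtosis_bound in W4 *.
have r0 : 0 <= m4 / m2 ^+ 2 by rewrite divr_ge0 ?sqr_ge0// normal_moment4_ge0.
move: (m4 / _) r0 W4 => r r0 W4.
have rAx : 0 <= r * (A * x) by apply: mulr_ge0 => //; apply: mulr_ge0.
have : 0 <= x ^+ 2 by exact: sqr_ge0.
nra.
Qed.

Let lex_ge (p q : 'I_d * R * R) :=
  (q.1.1 < p.1.1)%N || (q.1.1 == p.1.1) && (q.1.2 <= p.1.2).

Let lex_ge_trans : transitive lex_ge.
Proof.
move=> [[k u] a] [[j v] b] [[i z] c]; rewrite /lex_ge/=.
case/orP=> [kj|/andP[/eqP -> uv]]; case/orP=> [ik|/andP[/eqP -> zu]].
- by rewrite (ltn_trans ik kj).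
- by rewrite kj.
- by rewrite ik.
- by rewrite eqxx (le_trans zu uv) orbT.
Qed.

Let lex_ge_total : total lex_ge.
Proof.
move=> [[k u] a] [[j v] b]; rewrite /lex_ge/=.
case: (ltngtP j k) => //= [_|/ord_inj ->]; first by rewrite orbT.
by rewrite eqxx /=; exact: le_total.
Qed.

(** Abel summation from the latest term down.  The first term of l is merged with
b * incr k 0 t: if it is in the same direction k, at the time u, then
b * incr k 0 t = b * incr k 0 u + b * incr k u t, where the last increment is
independent of everything that remains; if it is in an earlier direction, then
incr k 0 t itself is independent of everything that remains. *)
Lemma kurtosis_le_sorted k t b l : 0 <= t -> all (fun p => 0 <= p.1.2) l ->
  path lex_ge (k, t, b) l -> kurtosis_le (fun w => lin_comb B l w + b * incr k 0 t w).
Proof.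
elim: l k t b => [|[[j u] a] l IH] k t b t0 /= l0 pl.
  apply: kurtosis_le_incr => //.
    by rewrite /lin_comb; under eq_fun do rewrite big_nil; exact: meas_wrt_cst.
  by rewrite /lin_comb; under eq_fun do rewrite big_nil; exact: kurtosis_le0.
case/andP: l0 => u0 l0; case/andP: pl => le1 pl.
have le2 := order_path_min lex_ge_trans pl.
have mpast i s : (j = i -> u <= s) ->
    (forall p, p \in l -> p.1.1 = i -> p.1.2 <= s) ->
    0 <= s ->
    forall c, meas_wrt (past i s) (fun w => lin_comb B l w + c * incr j 0 u w).
  move=> ju hl s0 c; apply: meas_wrtD; last first.
    apply: meas_wrtM; first exact: meas_wrt_cst.
    by apply: past_incr => // /ju.
  have -> : lin_comb B l = fun w => \sum_(p <- l)
      (if p \in l then p.2 * incr p.1.1 0 p.1.2 w else 0).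
    by apply/funext => w; rewrite -big_mkcond -big_seq.
  apply: meas_wrt_sum => p; have [pl'|_] := boolP (p \in l); last exact: meas_wrt_cst.
  apply: meas_wrtM; first exact: meas_wrt_cst.
  apply: past_incr => //; first exact: (allP l0).
  by move=> /(hl _ pl').
have [jk|jk] := eqVneq j k.
  have ut : u <= t.
    by move: le1; rewrite /lex_ge/= jk ltnn eqxx.
  have pl' : path lex_ge (j, u, a + b) l by case: (l) pl.
  have G := kurtosis_le_incr k u t _ b u0 ut _ (IH j u (a + b) u0 l0 pl').
  have E : (fun w => lin_comb B ((j, u, a) :: l) w + b * incr k 0 t w) =
      (fun w => lin_comb B l w + (a + b) * incr j 0 u w + b * incr k u t w).
    by apply/funext => w; rewrite /lin_comb big_cons jk /= /incr; ring.
  rewrite E; apply: G => //.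
  apply: mpast => // p /(allP le2); rewrite /lex_ge/= => + pk.
  by rewrite pk jk ltnn eqxx.
have jk' : (j < k)%N by move: le1; rewrite /lex_ge/= (negbTE jk) orbF.
have G := kurtosis_le_incr k 0 t _ b (lexx _) t0 _ (IH j u a u0 l0 pl).
have E : (fun w => lin_comb B ((j, u, a) :: l) w + b * incr k 0 t w) =
    (fun w => lin_comb B l w + a * incr j 0 u w + b * incr k 0 t w).
  by apply/funext => w; rewrite /lin_comb big_cons /=; ring.
rewrite E; apply: G; apply: mpast => //.
  by move=> jk0; rewrite jk0 eqxx in jk.
move=> p /(allP le2); rewrite /lex_ge/= => + pk.
rewrite pk; case/orP => [kj|/andP[/eqP kj _]].
  by have := ltn_trans jk' kj; rewrite ltnn.
by rewrite kj eqxx in jk.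
Qed.

Lemma gauss_span_kurtosis_le f : gauss_span B f -> kurtosis_le f.
Proof.
move=> [l [l0 /funext ->]].
have -> : lin_comb B l = lin_comb B (sort lex_ge l).
  by apply/funext => w; apply: perm_big; rewrite perm_sym perm_sort.
have : all (fun p => 0 <= p.1.2) (sort lex_ge l) by rewrite all_sort.
have := sort_sorted lex_ge_total l.
case: (sort _ _) => [_ _|[[k t] b] l' /= pl /andP[t0 l'0]].
  by rewrite /lin_comb; under eq_fun do rewrite big_nil; exact: kurtosis_le0.
have := kurtosis_le_sorted k t b l' t0 l'0 pl.
by congr kurtosis_le; apply/funext => w; rewrite /lin_comb big_cons addrC.
Qed.

End fourth_moment.

(** * Almost sure convergence implies convergence in mean square *)

Section reverse_hoelder.
Context {R : realType} {d' : measure_display} {Omega : measurableType d'}.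
Variables (P : probability Omega R) (V0 : (Omega -> R) -> Prop) (K : R).
Hypothesis K0 : 0 < K.
Hypothesis V0_L4 : forall f, V0 f -> L4 P f.
Hypothesis V0_kurt : forall f, V0 f ->
  Ex P (fun w => f w ^+ 4) <= K * Ex P (fun w => f w ^+ 2) ^+ 2.
Hypothesis V0B : forall f g, V0 f -> V0 g -> V0 (fun w => f w - g w).
Local Notation integ := (integ P).
Local Notation Ex := (Ex P).
Local Notation N := (mean_sqr P).

Implicit Types (f g h : Omega -> R) (a e : R).
(** The closure in L2 of a class of variables for which the fourth moment is
controlled by the square of the second. *)
Definition L2_closure f := measurable_fun setT f /\
  forall e, 0 < e -> exists2 g, V0 g & (N (fun w => f w - g w)%R <= e%:E)%E.

Let integ_indic A : measurable A -> integ \1_A.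
Proof. exact: integrable_indic. Qed.

Let measurable_sqr_ge h a : measurable_fun setT h ->
  measurable [set w | a <= h w ^+ 2].
Proof.
move=> mh; rewrite (_ : [set w | _] = (fun w => h w ^+ 2) @^-1` `[a, +oo[).
  by rewrite -[X in measurable X]setTI; apply: measurable_funX.
by apply/seteqP; split => w /=; rewrite in_itv/= andbT.
Qed.

(** Write c for E f^2 and A for the event.  Off A one has f^2 <= c/2, and on A the inequality between
the arithmetic and the geometric mean gives f^2 <= l f^4 + 1/(4 l).  The choice
l = 1/(4 K c) makes l E f^4 at most c/4, and 1/(4 l) equal to K c; there
remains c/4 <= K c P(A). *)
Lemma paley_zygmund f : V0 f -> 0 < Ex (fun w => f w ^+ 2) ->
  (4 * K)^-1 <= Ex \1_[set w | Ex (fun w => f w ^+ 2) / 2 <= f w ^+ 2].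
Proof.
move=> Vf; have [mf _] := V0_L4 _ Vf.
have I2 : integ (fun w => f w ^+ 2) := L4_pow P _ 2 (V0_L4 _ Vf) isT.
have I4 : integ (fun w => f w ^+ 4) := L4_pow P _ 4 (V0_L4 _ Vf) isT.
have := V0_kurt _ Vf.
set q := Ex (fun w => f w ^+ 4); set c := Ex (fun w => f w ^+ 2) => qc c0; set A := [set w | _].
have mA : measurable A by exact: measurable_sqr_ge.
have IA := integ_indic _ mA.
pose l := (4 * K * c)^-1.
have l0 : 0 < l by rewrite /l invr_gt0; apply: mulr_gt0 => //; apply: mulr_gt0.
have J := integD _ _ _ (integ_cst P (c / 2))
  (integD _ _ _ (integZ P l _ I4) (integZ P (K * c) _ IA)).
have : c <= Ex (fun w => c / 2 + (l * f w ^+ 4 + K * c * \1_A w)).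
  apply: le_Ex => // w; rewrite indicE; have [wA|wA] := boolP (w \in A).
    rewrite mulr1; have := sqr_ge0 (l * f w ^+ 2 - 2^-1).
    have -> : K * c = (4 * l)^-1.
      by rewrite /l; field; rewrite !gt_eqF.
    have -> : c / 2 + (l * f w ^+ 4 + (4 * l)^-1) =
        l^-1 * (l * f w ^+ 2 - 2^-1) ^+ 2 + f w ^+ 2 + c / 2.
      by field; rewrite gt_eqF.
    move=> h; rewrite -addrA addrC -addrA lerDl addr_ge0//.
      by rewrite divr_ge0// ltW.
    by rewrite mulr_ge0// invr_ge0 ltW.
  rewrite mulr0 addr0; move: wA; rewrite notin_setE /A /= => /negP; rewrite -ltNge => /ltW h.
  by rewrite (le_trans h)// lerDl mulr_ge0 ?(ltW l0)// (exprM _ 2 2) sqr_ge0.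
rewrite ExD//; [|exact: integ_cst|by apply: integD; exact: integZ].
rewrite Ex_cst ExD; [|exact: integZ|exact: integZ]; rewrite ExZ// ExZ//.
rewrite -/q; set p := Ex _ => h.
have lq : l * q <= c / 4.
  apply: (@le_trans _ _ (l * (K * c ^+ 2))); first by rewrite ler_wpM2l// ltW.
  by rewrite le_eqVlt; apply/orP; left; apply/eqP; rewrite /l; field; rewrite !gt_eqF.
have : c / 4 <= K * c * p by lra.
rewrite (_ : K * c * p = c * (K * p)); last by ring.
rewrite ler_pM2l// => h4.
by rewrite -(ler_pM2l K0) invfM mulrCA divff ?gt_eqF// mulr1.
Qed.

Lemma chebyshev2 h a : measurable_fun setT h -> 0 < a ->
  (a%:E * P [set w | (a <= h w ^+ 2)%R] <= N h)%E.
Proof.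
move=> mh a0; set D := [set w | _].
have mD : measurable D by exact: measurable_sqr_ge.
rewrite -[X in P X](@setIT _ D) -integral_indic// -ge0_integralZl//; last first.
- by rewrite lee_fin ltW.
- exact/measurable_EFinP.
apply: ge0_le_integral => //.
- by move=> w _; rewrite mule_ge0// lee_fin ltW.
- by apply: emeasurable_funM => //; exact/measurable_EFinP.
- by apply/measurable_EFinP; exact: measurable_funX.
- move=> w _; rewrite -EFinM lee_fin indicE; have [wD|_] := boolP (w \in D).
    by rewrite mulr1; move: wD; rewrite inE.
  by rewrite mulr0 sqr_ge0.
Qed.

Lemma L2_closure_meas f : L2_closure f -> measurable_fun setT f.
Proof. by case. Qed.

Lemma L2_closureB f g h : L2_closure f -> L2_closure g ->
  (forall w, h w = f w - g w) -> L2_closure h.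
Proof.
move=> [mf Vf] [mg Vg] hE; have -> : h = fun w => f w - g w by exact/funext.
split=> [|e e0]; first exact: measurable_funB.
have e4 : 0 < e / 4 by rewrite divr_gt0.
have [f' V0f' hf] := Vf _ e4; have [g' V0g' hg] := Vg _ e4.
have [mf' _] := V0_L4 _ V0f'; have [mg' _] := V0_L4 _ V0g'.
exists (fun w => f' w - g' w); first exact: V0B.
rewrite (_ : e = 2 * (e / 4) + 2 * (e / 4)); last by field.
apply: (mean_sqr_le2_fin P _ (fun w => f w - f' w) (fun w => g' w - g w)) => //.
- by apply: measurable_funB; exact: measurable_funB.
- exact: measurable_funB.
- exact: measurable_funB.
- by move=> w; ring.
- by rewrite (@mean_sqr_opp _ _ _ _ _ (fun w => g w - g' w)) // => w; rewrite opprB.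
Qed.

(** Approximate f by g in the class within eta.  Then E g^2 >= e/4, hence
g^2 >= e/8 with probability at least 1/(4K) by paley_zygmund.  There
f^2 >= e/32 unless (f - g)^2 >= e/32, which has probability at most
32 eta / e <= 1/(8K). *)
Lemma L2_closure_anticoncentration f e : L2_closure f -> 0 < e ->
  (e%:E <= N f)%E -> ((8 * K)^-1%:E <= P [set w | (e / 32 <= f w ^+ 2)%R])%E.
Proof.
move=> [mf Vf] e0 eN.
pose eta := Num.min (e / 4) (e / (256 * K)).
have eta0 : 0 < eta by rewrite lt_min !divr_gt0// mulr_gt0.
have [g V0g hg] := Vf _ eta0; have [mg _] := V0_L4 _ V0g.
have mfg : measurable_fun setT (fun w => f w - g w) by exact: measurable_funB.
have I2 : integ (fun w => g w ^+ 2) := L4_pow P _ 2 (V0_L4 _ V0g) isT.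
pose c := Ex (fun w => g w ^+ 2).
have ce : e / 4 <= c.
  have := mean_sqr_le2_fin P _ _ _ _ c mf mfg mg _ hg _.
  rewrite mean_sqr_Ex// -/c => /(_ _ (lexx _)) h.
  have : (e%:E <= (2 * eta + 2 * c)%:E)%E by apply: le_trans eN (h _) => w; rewrite subrK.
  have : eta <= e / 4 by rewrite ge_min lexx.
  rewrite lee_fin; lra.
have c0 : 0 < c by apply: lt_le_trans ce; rewrite divr_gt0.
have := paley_zygmund g V0g c0; rewrite -/c.
set Bs := [set w | _] => hB.
set A := [set w | e / 32 <= _]; pose D := [set w | e / 32 <= (f w - g w) ^+ 2].
have mA : measurable A by exact: measurable_sqr_ge.
have mD : measurable D by exact: measurable_sqr_ge.
have mB : measurable Bs by exact: measurable_sqr_ge.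
have BAD : Bs `<=` A `|` D.
  move=> w; rewrite /Bs /A /D /= => hw.
  have [|fw] := leP (e / 32) (f w ^+ 2); first by left.
  have [|fgw] := leP (e / 32) ((f w - g w) ^+ 2); first by right.
  by have := sqr_ge0 (2 * f w - g w); nra.
have PE X : measurable X -> P X = (Ex \1_X)%:E.
  by move=> mX; rewrite -ExE; [rewrite integral_indic// setIT|exact: integ_indic].
have e32 : 0 < e / 32 by rewrite divr_gt0.
have PD : Ex \1_D <= (8 * K)^-1.
  have := le_trans (chebyshev2 _ _ mfg e32) hg; rewrite -/D PE// -EFinM lee_fin => h.
  have : eta <= e / (256 * K) by rewrite ge_min lexx orbT.
  have -> : e / (256 * K) = e / 32 * (8 * K)^-1 by field; rewrite gt_eqF.
  by move=> /(le_trans h); rewrite ler_pM2l.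
have : (P Bs <= P A + P D)%E.
  apply: le_trans (measureU2 P _ _) => //.
  by apply: le_measure => //; rewrite ?inE//; exact: measurableU.
rewrite !PE// -EFinD !lee_fin => h.
have -> : (8 * K)^-1 = (4 * K)^-1 - (8 * K)^-1 by field; rewrite gt_eqF.
lra.
Qed.

(** Almost sure convergence to 0 makes the probability that Y n ^+ 2 >= e/32 tend
to 0, which contradicts the anticoncentration. *)
Lemma L2_closure_cvg0_absurd (Y : nat -> Omega -> R) e : 0 < e ->
  (forall n, L2_closure (Y n)) -> (forall n, (e%:E <= N (Y n))%E) ->
  {ae P, forall w, Y n w @[n --> \oo] --> 0} -> False.
Proof.
move=> e0 VY eY Y0; have e32 : 0 < e / 32 by rewrite divr_gt0.
pose A n := [set w | e / 32 <= Y n w ^+ 2].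
have mA n : measurable (A n).
  by apply: measurable_sqr_ge; exact: L2_closure_meas (VY n).
have m1 n : measurable_fun setT (fun w => (\1_(A n) w : R)%:E).
  by apply/measurable_EFinP; exact: measurable_indic.
have lim1 : {ae P, forall w, setT w -> (\1_(A n) w : R)%:E @[n --> \oo] --> cst 0%E w}.
  apply: (filterS _ Y0) => w Yw _; apply: cvg_near_cst.
  have Y2 : Y n w ^+ 2 @[n --> \oo] --> 0.
    have -> : 0 = 0 * 0 :> R by rewrite mulr0.
    by under eq_fun do rewrite expr2; exact: cvgM.
  have Yn : \forall n \near \oo, Y n w ^+ 2 < e / 32 by apply: (cvgr_lt _ Y2).
  apply: (filterS _ Yn) => n hn.
  by rewrite indicE memNset// /A /= => h; move: hn; rewrite ltNge h.
have dom1 : {ae P, forall w n, setT w -> (`|(\1_(A n) w : R)%:E| <= cst 1%:E w)%E}.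
  by apply/aeW => w n _ /=; rewrite lee_fin indicE; case: (_ \in _); rewrite ?normr1 ?normr0.
have [_ _] := dominated_convergence measurableT m1 (measurable_cst _) lim1
  (finite_measure_integrable_cst P 1 measurableT) dom1.
rewrite integral0 => I0.
have K8 : 0 < (8 * K)^-1 by rewrite invr_gt0 mulr_gt0.
have [n _ /(_ n (leqnn n))] := cvg0e_near _ _ _ _ _ I0 K8.
rewrite /= integral_indic// setIT ltNge => /negP; apply.
exact: L2_closure_anticoncentration.
Qed.

(** The sequence is Cauchy in L2: otherwise some differences Y n - Y m with n and m
arbitrarily large, which tend to 0 almost surely, would keep a second moment
bounded below.  By the lemma of Fatou the L2 limit is the almost sure limit. *)
Lemma L2_closure_ae_cvg (Y : nat -> Omega -> R) (Z : Omega -> R) :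
  (forall n, L2_closure (Y n)) -> measurable_fun setT Z ->
  {ae P, forall w, Y n w @[n --> \oo] --> Z w} ->
  L2_closure Z /\ (forall e, 0 < e ->
    \forall n \near \oo, (N (fun w => Y n w - Z w)%R <= e%:E)%E).
Proof.
move=> VY mZ YZ.
have mY n := L2_closure_meas _ (VY n).
have VB n m : L2_closure (fun w => Y n w - Y m w).
  exact: L2_closureB (VY n) (VY m) (fun=> erefl).
have cauchy e : 0 < e -> exists n0, forall n m, (n0 <= n)%N -> (n0 <= m)%N ->
    (N (fun w => Y n w - Y m w)%R <= e%:E)%E.
  move=> e0; apply: contrapT => /forallNP nC.
  have {}nC n0 : exists p : nat * nat, [/\ (n0 <= p.1)%N, (n0 <= p.2)%N &
      (e%:E <= N (fun w => Y p.1 w - Y p.2 w)%R)%E].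
    have := nC n0; move=> /existsNP[n] /existsNP[m] /not_implyP[n0n] /not_implyP[n0m].
    by move=> /negP; rewrite -ltNge => /ltW h; exists (n, m).
  have [p hp] := choice nC.
  apply: (@L2_closure_cvg0_absurd (fun n w => Y (p n).1 w - Y (p n).2 w) e) => //.
    by move=> n; have [] := hp n.
  apply: (filterS _ YZ) => w Yw; rewrite -(subrr (Z w)).
  have sub (q : nat -> nat) : (forall n, (n <= q n)%N) -> Y (q n) w @[n --> \oo] --> Z w.
    move=> qn; apply: (cvg_comp q (Y ^~ w) _ Yw).
    by apply/cvgnyPge => a; exists a => // n /= an; exact: leq_trans (qn n).
  by apply: cvgB; apply: sub => n; have [] := hp n.
have close e : 0 < e -> \forall n \near \oo, (N (fun w => Y n w - Z w)%R <= e%:E)%E.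
  move=> e0; have [n0 hn0] := cauchy e e0.
  exists n0 => // n /= n0n.
  (* The shift by n0 makes every term of the sequence satisfy the Cauchy bound. *)
  pose u (j : nat) w := ((Y n w - Y (n0 + j)%N w) ^+ 2)%:E.
  have mu j : measurable_fun setT (u j).
    by apply/measurable_EFinP; apply: measurable_funX; exact: measurable_funB.
  have u0 j w : setT w -> (0 <= u j w)%E by move=> _; rewrite lee_fin sqr_ge0.
  have := fatou P measurableT mu u0.
  rewrite (@ge0_ae_eq_integral _ _ _ P setT _ (fun w => ((Y n w - Z w) ^+ 2)%:E)).
  - move=> /le_trans; apply; rewrite limn_einf_lim; apply: lime_le.
      exact: is_cvg_einfs.
    apply: nearW => j; apply: (@le_trans _ _ (N (fun w => Y n w - Y (n0 + j)%N w)%R)).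
      by apply: ereal_inf_lbound; exists j => /=.
    by apply: hn0 => //; exact: leq_addr.
  - by [].
  - under eq_fun do rewrite /limn_einf; apply: measurableT_comp => //.
    apply: measurable_fun_limn_esup => j; exact: measurableT_comp.
  - by apply/measurable_EFinP; apply: measurable_funX; exact: measurable_funB.
  - move=> w _; rewrite limn_einf_lim; apply: lime_ge; first exact: is_cvg_einfs.
    by apply: nearW => j; apply: le_ereal_inf_tmp => _ [i _ <-]; exact: u0.
  - by move=> w _; rewrite lee_fin sqr_ge0.
  apply: (filterS _ YZ) => w Yw _.
  have uZ : u j w @[j --> \oo] --> ((Y n w - Z w) ^+ 2)%:E.
    have h : Y n w - Y (n0 + j)%N w @[j --> \oo] --> Y n w - Z w.
      apply: cvgB; first exact: cvg_cst.
      apply: (cvg_comp (addn n0) (Y ^~ w) _ Yw).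
      by apply/cvgnyPge => a; exists a => // j /= aj; rewrite (leq_trans aj)// leq_addl.
    have h2 : (Y n w - Y (n0 + j)%N w) ^+ 2 @[j --> \oo] --> (Y n w - Z w) ^+ 2.
      by apply: (cvg_comp _ (fun z => z ^+ 2) h); exact: sqr_continuous.
    by apply/cvg_EFin; first by apply: nearW.
  by rewrite /= (cvg_limn_einf_sup uZ).1.
split => //; split => // e e0; have e4 : 0 < e / 4 by rewrite divr_gt0.
have [n _ /(_ n (leqnn n)) hn] := close _ e4.
have [_ /(_ _ e4)[g V0g hg]] := VY n.
have [mg _] := V0_L4 _ V0g.
exists g => //; rewrite (_ : e = 2 * (e / 4) + 2 * (e / 4)); last by field.
apply: (mean_sqr_le2_fin P _ (fun w => Z w - Y n w) (fun w => Y n w - g w)) => //.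
- exact: measurable_funB.
- exact: measurable_funB.
- exact: measurable_funB.
- by move=> w; ring.
- by rewrite (@mean_sqr_opp _ _ _ _ _ (fun w => Y n w - Z w)) // => w; rewrite opprB.
Qed.

(** A real parameter t reduces to sequences, because convergence is refuted along a
sequence of times that goes to infinity. *)
Lemma L2_closure_cvg0 (Y : R -> Omega -> R) :
  (forall t, 0 <= t -> L2_closure (Y t)) ->
  {ae P, forall w, Y t w @[t --> +oo%R] --> 0} ->
  N (Y t) @[t --> +oo%R] --> 0%E.
Proof.
move=> VY Y0; apply: near_cvg0e; first by apply: nearW => t; exact: mean_sqr_ge0.
move=> e e0; apply: contrapT => h.
have nC (n : nat) : exists t, n%:R <= t /\ (e%:E <= N (Y t))%E.
  apply: contrapT => /forallNP nt; apply: h; exists n%:R; split => // t nt'.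
  have := nt t => /not_andP[/(_ (ltW nt'))//|/negP]; rewrite -ltNge; exact: ltW.
have [t ht] := choice nC.
apply: (@L2_closure_cvg0_absurd (fun n => Y (t n)) e) => //.
- by move=> n; apply: VY; have [h1 _] := ht n; exact: le_trans h1.
- by move=> n; have [] := ht n.
apply: (filterS _ Y0) => w Yw; apply: (cvg_comp t (Y ^~ w) _ Yw).
apply/cvgryPge => a; near=> n; have [h1 _] := ht n; apply: le_trans h1.
by near: n; exact: nbhs_infty_ger.
Unshelve. all: by end_near. Qed.

End reverse_hoelder.

(** * Rows of matrix-valued Ito integrals *)

Section rows.
Context {R : realType} {d' : measure_display} {Omega : measurableType d'}.
Context {P : probability Omega R} {d : nat} {B : 'I_d -> R -> Omega -> R}.
Hypothesis hB : brownian_vector P B.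
Local Notation m2 := (@normal_moment R 2).
Local Notation step := (step B).
Local Notation F := (natural_filtration B).
Local Notation mu := (@lebesgue_measure R).
Local Notation N := (mean_sqr P).
Implicit Types (f X Y : Omega -> R).

Definition gaussian := L2_closure P (gauss_span B).

Lemma kurtosis_bound_gt0 : 0 < @kurtosis_bound R.
Proof. by rewrite /kurtosis_bound ltr_wpDr// divr_ge0 ?sqr_ge0// normal_moment4_ge0. Qed.

Lemma gauss_span_L4 f : gauss_span B f -> L4 P f.
Proof. by case/(gauss_span_kurtosis_le hB). Qed.

Lemma gauss_span_moment4 f : gauss_span B f ->
  Ex P (fun w => f w ^+ 4) <= kurtosis_bound * Ex P (fun w => f w ^+ 2) ^+ 2.
Proof. by case/(gauss_span_kurtosis_le hB). Qed.

Lemma gauss_spanB f (g : Omega -> R) : gauss_span B f -> gauss_span B g ->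
  gauss_span B (fun w => f w - g w).
Proof.
move=> hf hg; apply: (gauss_spanD B f (fun w => -1 * g w)) => // [|w].
  exact: (gauss_spanZ B (-1) g).
by rewrite mulN1r.
Qed.

Lemma gaussianB f (g h : Omega -> R) : gaussian f -> gaussian g ->
  (forall w, h w = f w - g w) -> gaussian h.
Proof. exact: L2_closureB gauss_span_L4 gauss_spanB _ _ _. Qed.

Lemma gaussian0 : gaussian (fun=> 0).
Proof.
split => // e e0; exists (fun=> 0); first exact: gauss_span0.
rewrite /mean_sqr (eq_integral (cst 0%E)); last by move=> w _; rewrite subrr expr0n.
by rewrite integral0 lee_fin ltW.
Qed.

Lemma gaussian_sum (I : Type) (s : seq I) (f : I -> Omega -> R) (h : Omega -> R) :
  (forall i, gaussian (f i)) -> (forall w, h w = \sum_(i <- s) f i w) -> gaussian h.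
Proof.
move=> fG; elim: s h => [|i s IH] h hE.
  have -> : h = fun=> 0 by apply/funext => w; rewrite hE big_nil.
  exact: gaussian0.
have G : gaussian (fun w => 0 - \sum_(i <- s) f i w).
  by apply: (gaussianB _ _ _ gaussian0 (IH _ (fun=> erefl))).
apply: (gaussianB _ _ _ (fG i) G) => w.
by rewrite hE big_cons sub0r opprK.
Qed.

(** For eps = min(1, e / (c + 1)) one has c eps^2 <= c eps <= e. *)
Lemma exists_small_sqr (c e : R) : 0 <= c -> 0 < e ->
  exists eps, [/\ 0 < eps, eps <= 1, eps <= e & c * eps ^+ 2 <= e].
Proof.
move=> c0 e0; pose eps := Num.min 1 (e / (c + 1)).
have c1 : 0 < c + 1 by rewrite ltr_wpDl.
have e1 : eps <= 1 by rewrite ge_min lexx.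
have ee : eps <= e / (c + 1) by rewrite ge_min lexx orbT.
have p0 : 0 < eps by rewrite lt_min ltr01 divr_gt0.
have ce : (c + 1) * eps <= e by rewrite mulrC -ler_pdivlMr.
exists eps; split => //; first by nra.
have : eps ^+ 2 <= eps by nra.
by nra.
Qed.

Lemma ito_gaussian k t (g : R -> R) Y : 0 <= t -> {within `[0, t], continuous g} ->
  is_ito_integral P F (B k) (fun s _ => g s) t Y -> gaussian Y.
Proof.
move=> t0 cg hY; split; first by case: hY.
move=> e e0; have c0 : 0 <= 4 * m2 * t by rewrite !mulr_ge0// ltW// normal_moment2_gt0.
have [eps [p0 _ _ pe]] := exists_small_sqr _ _ c0 e0.
have [L HL] := det_approx_exists B k t eps g t0 p0 cg.
exists (steps_int L); first exact: det_span HL.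
apply: le_trans (ito_approx hB k t eps g L t0 (ltW p0) cg HL Y hY) _.
by rewrite lee_fin mulrA.
Qed.

Lemma mean_sqr_sum_le (I : Type) (s : seq I) (f : I -> Omega -> R) a : 0 <= a ->
  (forall i, measurable_fun setT (f i)) -> (forall i, (N (f i) <= a%:E)%E) ->
  (N (fun w => \sum_(i <- s) f i w)%R <= (4 ^+ size s * a)%:E)%E.
Proof.
move=> a0 mf fa; elim: s => [|i s IH].
  rewrite /mean_sqr (eq_integral (cst 0%E)); last by move=> w _; rewrite big_nil expr0n.
  by rewrite integral0 expr0 mul1r lee_fin.
have mS s' : measurable_fun setT (fun w => \sum_(i <- s') f i w).
  exact: measurable_sum.
apply: le_trans (mean_sqr_le2_fin P _ (f i) (fun w => \sum_(i <- s) f i w) _ _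
  (mS _) (mf i) (mS s) _ (fa i) IH) _.
  by move=> w; rewrite big_cons.
rewrite lee_fin /= exprS.
have : 1 <= 4 ^+ size s :> R by rewrite exprn_ege1// ler1n.
by move: (4 ^+ _) => q q1; nra.
Qed.

Lemma flatten_steps_val (I : Type) (s : seq I) (L : I -> seq step) k u w :
  steps_val (flatten [seq L i | i <- s]) k u w = \sum_(i <- s) steps_val (L i) k u w.
Proof.
elim: s => [|i s IH] /=; first by rewrite /steps_val !big_nil.
by rewrite cat_steps_val IH big_cons.
Qed.

Lemma flatten_steps_int (I : Type) (s : seq I) (L : I -> seq step) w :
  steps_int (flatten [seq L i | i <- s]) w = \sum_(i <- s) steps_int (L i) w.
Proof.
elim: s => [|i s IH] /=; first by rewrite /steps_int !big_nil.
by rewrite cat_steps_int IH big_cons.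
Qed.

(** The approximations of the d integrands are put into one sequence of steps, so
that the isometry can be applied to a whole row at once. *)
Lemma row_approx t (g : 'I_d -> R -> R) e : 0 <= t -> 0 < e ->
  (forall k, {within `[0, t], continuous (g k)}) ->
  exists L : seq step,
    [/\ forall k s w, 0 < s <= t -> `|steps_val L k s w - g k s| <= e,
        forall k s w, ~~ (0 < s <= t) -> steps_val L k s w = 0
      & forall Z : 'I_d -> Omega -> R,
        (forall k, is_ito_integral P F (B k) (fun s _ => g k s) t (Z k)) ->
        (N (fun w => \sum_k Z k w - steps_int L w)%R <= e%:E)%E].
Proof.
move=> t0 e0 cg; pose q : R := 4 ^+ size (index_enum 'I_d).
have q0 : 0 <= q by exact: exprn_ge0.
have m20 : 0 <= m2 by exact/ltW/normal_moment2_gt0.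
have c0 : 0 <= q * (4 * m2 * t) by rewrite !mulr_ge0.
have [eps [p0 _ pe1 pe]] := exists_small_sqr _ _ c0 e0.
have [L HL] := choice (fun k => det_approx_exists B k t eps (g k) t0 p0 (cg k)).
have valE k s w : steps_val (flatten [seq L i | i <- index_enum 'I_d]) k s w =
    steps_val (L k) k s w.
  rewrite flatten_steps_val (bigD1 k)//= big1 ?addr0// => j jk.
  by rewrite (det_dir _ _ _ _ _ _ (HL j))// eq_sym.
exists (flatten [seq L i | i <- index_enum 'I_d]); split.
- by move=> k s w st; rewrite valE (le_trans _ pe1)// (det_close _ _ _ _ _ _ (HL k)).
- by move=> k s w st; rewrite valE (det_supp _ _ _ _ _ _ (HL k)).
move=> Z hZ; have mZ k : measurable_fun setT (Z k) by case: (hZ k).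
rewrite (@eq_mean_sqr _ _ _ _ _ (fun w =>
    \sum_(k <- index_enum 'I_d) (Z k w - steps_int (L k) w))); last first.
  by move=> w; rewrite flatten_steps_int sumrB.
have b0 : 0 <= 4 * m2 * (t * eps ^+ 2).
  by apply: mulr_ge0; apply: mulr_ge0 => //; exact: sqr_ge0.
apply: le_trans (mean_sqr_sum_le _ _ _ _ b0 _ _) _.
- by move=> k; apply: measurable_funB => //; exact: (steps_int_meas hB).
- by move=> k; apply: (ito_approx hB k t eps (g k)) => //; exact: ltW.
by rewrite lee_fin -/q (le_trans _ pe)// le_eqVlt !mulrA eqxx.
Qed.

Definition is_row_ito (g : 'I_d -> R -> R) t X :=
  exists Z : 'I_d -> Omega -> R,
    (forall k, is_ito_integral P F (B k) (fun s _ => g k s) t (Z k)) /\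
    (forall w, X w = \sum_k Z k w).

Lemma row_meas (g : 'I_d -> R -> R) t X : is_row_ito g t X -> measurable_fun setT X.
Proof.
move=> [Z [hZ /funext ->]]; apply: measurable_sum => k.
by case: (hZ k).
Qed.

Lemma row_gaussian (g : 'I_d -> R -> R) t X : 0 <= t ->
  (forall k, {within `[0, t], continuous (g k)}) ->
  is_row_ito g t X -> gaussian X.
Proof.
move=> t0 cg [Z [hZ XE]]; apply: gaussian_sum XE => k.
exact: ito_gaussian t0 (cg k) (hZ k).
Qed.

Lemma row_unique (g : 'I_d -> R -> R) t X X' : 0 <= t ->
  (forall k, {within `[0, t], continuous (g k)}) ->
  is_row_ito g t X -> is_row_ito g t X' -> N (fun w => X w - X' w)%R = 0%E.
Proof.
move=> t0 cg hX hX'; have mX := row_meas _ _ _ hX; have mX' := row_meas _ _ _ hX'.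
apply/eqP; rewrite eq_le mean_sqr_ge0 andbT; apply/lee_addgt0Pr => e e0; rewrite add0e.
have e4 : 0 < e / 4 by rewrite divr_gt0.
have [L [_ _ HL]] := row_approx t g (e / 4) t0 e4 cg.
have mL := steps_int_meas hB L.
case: hX => Z [hZ ZE]; case: hX' => Z' [hZ' ZE'].
have h1 : (N (fun w => X w - steps_int L w)%R <= (e / 4)%:E)%E.
  by rewrite (funext ZE); exact: HL.
have h2 : (N (fun w => steps_int L w - X' w)%R <= (e / 4)%:E)%E.
  rewrite (@mean_sqr_opp _ _ _ _ _ (fun w => X' w - steps_int L w)); last first.
    by move=> w; rewrite opprB.
  by rewrite (funext ZE'); exact: HL.
rewrite (_ : e = 2 * (e / 4) + 2 * (e / 4)); last by field.
apply: mean_sqr_le2_fin h1 h2; try exact: measurable_funB.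
by move=> w; ring.
Qed.

(** For the deterministic step functions L and L' that approximate g and h the
isometry gives m2 times the integral of (L - L')^2, summed over the directions,
as the second moment of the difference of the integrals.  Keeping only the
direction k and the interval ]0, t], where (g - h)^2 <= 2 (L - L')^2 + 8 e^2,
and letting e tend to 0 gives the claim. *)
Lemma row_lower_bound t m (g h : 'I_d -> R -> R) X X' a k : 0 <= t -> t <= m ->
  (forall k, {within `[0, t], continuous (g k)}) ->
  (forall k, {within `[0, m], continuous (h k)}) ->
  is_row_ito g t X -> is_row_ito h m X' -> (N (fun w => X w - X' w)%R <= a%:E)%E ->
  (\int[mu]_(s in `[0%R, t]) ((g k s - h k s)%R ^+ 2)%:E <= (16 / m2 * a)%:E)%E.
Proof.
move=> t0 tm cg ch hX hX' Xa; have mX := row_meas _ _ _ hX; have mX' := row_meas _ _ _ hX'.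
have m0 : 0 <= m by exact: le_trans tm.
have m20 : 0 < m2 by exact: normal_moment2_gt0.
have mgh : measurable_fun `[0, t] (fun s => ((g k s - h k s)%R ^+ 2)%:E).
  apply/measurable_EFinP; apply: measurable_funX; apply: measurable_funB.
    by apply: subspace_continuous_measurable_fun => //; exact: cg.
  apply: subspace_continuous_measurable_fun => //.
  apply: continuous_subspaceW (ch k) => s /=; rewrite !in_itv/= => /andP[-> st].
  exact: le_trans tm.
apply/lee_addgt0Pr => r r0.
have c0 : 0 <= 24 / m2 + 8 * t by rewrite addr_ge0 ?mulr_ge0 ?invr_ge0// ltW.
(* The error terms add up to (24 / m2) e + 8 t e^2, and e^2 <= e. *)
pose e := Num.min 1 (r / (24 / m2 + 8 * t + 1)).
have e1 : e <= 1 by rewrite ge_min lexx.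
have e0 : 0 < e by rewrite lt_min ltr01 divr_gt0// ltr_wpDl.
have er : (24 / m2 + 8 * t) * e <= r.
  have : e <= r / (24 / m2 + 8 * t + 1) by rewrite ge_min lexx orbT.
  by rewrite ler_pdivlMr ?ltr_wpDl// => ?; nra.
have [L [Lval Lsupp HL]] := row_approx t g e t0 e0 cg.
have [L' [L'val L'supp HL']] := row_approx m h e m0 e0 ch.
have mL := steps_int_meas hB L; have mL' := steps_int_meas hB L'.
pose D := L ++ map neg_step L'.
have DE w : steps_int D w = steps_int L w - steps_int L' w.
  by rewrite cat_steps_int neg_steps_int.
have Dval j s w : steps_val D j s w = steps_val L j s w - steps_val L' j s w.
  by rewrite cat_steps_val neg_steps_val.
have [ID ED] := ito_isometry hB D.
have mD : measurable_fun setT (steps_int D) by exact: (steps_int_meas hB).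
have ND : (N (steps_int D) <= (12 * e + 8 * a)%:E)%E.
  case: hX => Z [hZ ZE]; case: hX' => Z' [hZ' ZE'].
  have h1 : (N (fun w => X w - steps_int L w)%R <= e%:E)%E by rewrite (funext ZE); exact: HL.
  have h1' : (N (fun w => steps_int L w - X w)%R <= e%:E)%E.
    by rewrite (@mean_sqr_opp _ _ _ _ _ (fun w => X w - steps_int L w))// => w; rewrite opprB.
  have h2 : (N (fun w => X' w - steps_int L' w)%R <= e%:E)%E by rewrite (funext ZE'); exact: HL'.
  have h3 := mean_sqr_le2_fin P (fun w => X w - X' w + (X' w - steps_int L' w)) _ _ _ _
    (measurable_funD (measurable_funB mX mX') (measurable_funB mX' mL'))
    (measurable_funB mX mX') (measurable_funB mX' mL') (fun=> erefl) Xa h2.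
  apply: le_trans (mean_sqr_le2_fin P (steps_int D) _ _ _ _ mD (measurable_funB mL mX)
    (measurable_funD (measurable_funB mX mX') (measurable_funB mX' mL')) _ h1' h3) _.
    by move=> w /=; rewrite DE; ring.
  rewrite lee_fin; have : 0 <= a by rewrite -lee_fin (le_trans (mean_sqr_ge0 _ _) Xa).
  by move: e0; lra.
have q0 w : 0 <= steps_sqr D k w by exact: steps_sqr_ge0.
have Iq := integ_steps_sqr hB D k.
have Eq : Ex P (steps_sqr D k) <= (12 * e + 8 * a) / m2.
  rewrite ler_pdivlMr// mulrC; move: ND; rewrite mean_sqr_Ex// lee_fin; apply: le_trans.
  rewrite ED ler_pM2l// (bigD1 k)//= lerDl; apply: sumr_ge0 => j _.
  by apply: Ex_ge0 => w; exact: steps_sqr_ge0.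
set J := (\int[mu]_(_ in _) _)%E.
have Jq w : (J <= (2 * steps_sqr D k w + 8 * e ^+ 2 * t)%:E)%E.
  have mDs : measurable_fun setT (fun s => steps_val D k s w).
    exact: (measurableT_comp (measurable_joint_val hB D k) (@measurable_pair1 _ _ Omega R w)).
  have mD2 : measurable_fun setT (fun s => (steps_val D k s w ^+ 2)%:E).
    by apply/measurable_EFinP; exact: measurable_funX.
  have sub : `]0, t] `<=` `[0, t]%classic by exact: subset_itv_oc_cc.
  rewrite /J -integral_itv_obnd_cbnd; last exact: measurable_funS mgh.
  apply: (@le_trans _ _ (\int[mu]_(s in `]0%R, t])
      (2%:E * (steps_val D k s w ^+ 2)%:E + (8 * e ^+ 2)%:E))%E).
    apply: ge0_le_integral => //=.
    - by move=> s _; rewrite lee_fin sqr_ge0.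
    - exact: measurable_funS mgh.
    - apply: measurable_funTS; apply: emeasurable_funD => //.
      exact: emeasurable_funM.
    move=> s; rewrite in_itv/= => /andP[s0 st]; rewrite -EFinM -EFinD lee_fin Dval.
    have h1 : 0 < s <= t by rewrite s0.
    have h2 : 0 < s <= m by rewrite s0 (le_trans st).
    have := Lval k s w h1; have := L'val k s w h2; rewrite !ler_norml.
    move: (steps_val L k s w) (steps_val L' k s w) (g k s) (h k s) => x y u v.
    move=> /andP[y1 y2] /andP[x1 x2].
    have : ((u - v) - (x - y)) ^+ 2 <= 4 * e ^+ 2 by nra.
    by have := sqr_ge0 ((u - v) - 2 * (x - y)); nra.
  rewrite ge0_integralD//=; last 3 first.
  - by move=> s _; rewrite -EFinM lee_fin mulr_ge0// sqr_ge0.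
  - by apply: measurable_funTS; exact: emeasurable_funM.
  - by move=> s _; rewrite lee_fin mulr_ge0// sqr_ge0.
  rewrite ge0_integralZl//; last 2 first.
  - exact: measurable_funTS.
  - by move=> s _; rewrite lee_fin sqr_ge0.
  rewrite (EFinD (2 * steps_sqr D k w)) (EFinM 2 (steps_sqr D k w)); apply: leeD.
    apply: lee_wpmul2l => //; rewrite -steps_sqrE.
    by apply: ge0_subset_integral => // s _; rewrite lee_fin sqr_ge0.
  rewrite integral_cst//= lebesgue_measure_itv/= lte_fin; case: ifPn => _.
    by rewrite -EFinD -EFinM lee_fin subr0.
  rewrite mule0 lee_fin; apply: mulr_ge0 => //; apply: mulr_ge0 => //; exact: sqr_ge0.
have Jfin : J \is a fin_num.
  rewrite ge0_fin_numE; first exact: le_lt_trans (Jq point) (ltry _).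
  by apply: integral_ge0 => s _; rewrite lee_fin sqr_ge0.
rewrite -(fineK Jfin) -EFinD lee_fin.
have : fine J <= Ex P (fun w => 2 * steps_sqr D k w + 8 * e ^+ 2 * t).
  rewrite -[leLHS](Ex_cst P); apply: le_Ex; first exact: integ_cst.
    by apply: integD; [exact: integZ|exact: integ_cst].
  by move=> w; rewrite -lee_fin fineK.
rewrite ExD; [|exact: integZ|exact: integ_cst].
rewrite ExZ// Ex_cst => /le_trans; apply.
have e2 : e ^+ 2 <= e by nra.
have : 8 * e ^+ 2 * t <= 8 * t * e by nra.
have -> : 16 / m2 * a = 2 * (8 * a / m2) by field; rewrite gt_eqF.
have : (24 / m2 + 8 * t) * e = 2 * (12 * e / m2) + 8 * t * e by field; rewrite gt_eqF.
move: Eq; rewrite mulrDl.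
by move: er; lra.
Qed.

End rows.

(** * Limits of rows *)

Section row_limits.
Context {R : realType} {d' : measure_display} {Omega : measurableType d'}.
Context {P : probability Omega R} {d : nat} {B : 'I_d -> R -> Omega -> R}.
Hypothesis hB : brownian_vector P B.
Local Notation m2 := (@normal_moment R 2).
Local Notation mu := (@lebesgue_measure R).
Local Notation N := (mean_sqr P).
Local Notation is_row_ito := (@is_row_ito R d' Omega P d B).
Local Notation gaussian := (@gaussian R d' Omega P d B).

Definition is_row_improper (h : 'I_d -> R -> R) (Xinf : Omega -> R) :=
  measurable_fun setT Xinf /\ exists X : R -> Omega -> R,
    (forall t, 0 <= t -> is_row_ito h t (X t)) /\
    {ae P, forall w, X t w @[t --> +oo%R] --> Xinf w}.

Let kurt0 : 0 < @kurtosis_bound R := kurtosis_bound_gt0.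

Variable h : 'I_d -> R -> R.
Hypothesis ch : forall t, 0 <= t -> forall k, {within `[0, t], continuous (h k)}.

(** The second claim is uniform in the version X of the integral over [0, n], since
any two versions are at distance 0. *)
Lemma row_improper Xinf : is_row_improper h Xinf ->
  gaussian Xinf /\ forall e, 0 < e -> exists n0 : nat, forall n X, (n0 <= n)%N ->
    is_row_ito h n%:R X -> (N (fun w => X w - Xinf w)%R <= e%:E)%E.
Proof.
move=> [mXinf [X [hX Xcvg]]].
have n0 n : 0 <= n%:R :> R by [].
have GX n : gaussian (X n%:R).
  exact: (row_gaussian hB h _ _ (n0 n) (ch _ (n0 n)) (hX _ (n0 n))).
have Xcvgn : {ae P, forall w, X n%:R w @[n --> \oo] --> Xinf w}.
  apply: (filterS _ Xcvg) => w Xw; apply: (cvg_comp (fun n => n%:R) (X ^~ w) _ Xw).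
  exact: cvgr_idn.
have [GXinf Xlim] := L2_closure_ae_cvg P _ _ kurt0 (gauss_span_L4 hB)
  (gauss_span_moment4 hB) gauss_spanB _ _ GX mXinf Xcvgn.
split => // e e0; have e4 : 0 < e / 4 by rewrite divr_gt0.
have [k _ hk] := Xlim _ e4; exists k => n X' kn hX'.
have mX' := row_meas _ _ _ hX'; have mX : measurable_fun setT (X n%:R) by case: (GX n).
have U := row_unique hB _ _ _ _ (n0 n) (ch _ (n0 n)) hX' (hX _ (n0 n)).
rewrite (_ : e = 2 * (e / 4) + 2 * (e / 4)); last by field.
apply: (mean_sqr_le2_fin P _ (fun w => X' w - X n%:R w) (fun w => X n%:R w - Xinf w)).
- exact: measurable_funB.
- exact: measurable_funB.
- exact: measurable_funB.
- by move=> w; ring.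
- by rewrite U lee_fin ltW.
- exact: hk.
Qed.

Lemma row_improper_unique Xinf Xinf' : is_row_improper h Xinf ->
  is_row_improper h Xinf' -> N (fun w => Xinf w - Xinf' w)%R = 0%E.
Proof.
move=> hX hX'; have [[mX _] l] := row_improper _ hX.
have [[mX' _] l'] := row_improper _ hX'.
apply/eqP; rewrite eq_le mean_sqr_ge0 andbT; apply/lee_addgt0Pr => e e0; rewrite add0e.
have e4 : 0 < e / 4 by rewrite divr_gt0.
have [n hn] := l _ e4; have [n' hn'] := l' _ e4.
case: hX => _ [Y [hY _]]; pose m := maxn n n'.
have Ym := hY m%:R (ler0n _ _).
have mY := row_meas _ _ _ Ym.
rewrite (_ : e = 2 * (e / 4) + 2 * (e / 4)); last by field.
apply: (mean_sqr_le2_fin P _ (fun w => Xinf w - Y m%:R w) (fun w => Y m%:R w - Xinf' w)).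
- exact: measurable_funB.
- exact: measurable_funB.
- exact: measurable_funB.
- by move=> w; ring.
- rewrite (@mean_sqr_opp _ _ _ _ _ (fun w => Y m%:R w - Xinf w)); last by move=> w; rewrite opprB.
  by apply: (hn m) => //; exact: leq_maxl.
- by apply: (hn' m) => //; exact: leq_maxr.
Qed.

Variable g : R -> 'I_d -> R -> R.
Hypothesis cg : forall t, 0 <= t -> forall k, {within `[0, t], continuous (g t k)}.
Variables (X : R -> Omega -> R) (Xinf : Omega -> R).
Hypotheses (hX : forall t, 0 <= t -> is_row_ito (g t) t (X t))
  (hXinf : is_row_improper h Xinf)
  (Xcvg : {ae P, forall w, X t w @[t --> +oo%R] --> Xinf w}).

(** The differences X t - Xinf are Gaussian and tend to 0 almost surely. *)
Lemma row_L2_cvg : N (fun w => X t w - Xinf w)%R @[t --> +oo%R] --> 0%E.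
Proof.
have [GXinf _] := row_improper _ hXinf.
apply: (L2_closure_cvg0 P _ _ kurt0 (gauss_span_L4 hB) (gauss_span_moment4 hB)
  (fun t w => X t w - Xinf w)).
  move=> t t0; apply: (gaussianB hB (X t) Xinf) => //.
  exact: (row_gaussian hB _ _ _ t0 (cg _ t0) (hX _ t0)).
apply: (filterS _ Xcvg) => w Xw; rewrite -(subrr (Xinf w)).
by apply: cvgB => //; exact: cvg_cst.
Qed.

(** Almost sure convergence is a property of one version of the integrals, but the
conclusion depends only on their classes modulo null sets. *)
Lemma row_L2_cvg_version (Y : R -> Omega -> R) (Yinf : Omega -> R) :
  (forall t, 0 <= t -> is_row_ito (g t) t (Y t)) -> is_row_improper h Yinf ->
  N (fun w => Y t w - Yinf w)%R @[t --> +oo%R] --> 0%E.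
Proof.
move=> hY hYinf; apply: near_cvg0e; first by apply: nearW => t; exact: mean_sqr_ge0.
move=> e e0; have e4 : 0 < e / 4 by rewrite divr_gt0.
have near0 : \forall t \near +oo%R, 0 <= t :> R by exact: nbhs_pinfty_ge.
apply: (filterS _ (filterI near0 (cvg0e_near _ _ _ _ _ row_L2_cvg e4))) => t [t0 /ltW ht].
have mX := row_meas _ _ _ (hX _ t0); have mY := row_meas _ _ _ (hY _ t0).
have mXinf : measurable_fun setT Xinf by case: hXinf.
have mYinf : measurable_fun setT Yinf by case: hYinf.
have U := row_unique hB _ _ _ _ t0 (cg _ t0) (hY _ t0) (hX _ t0).
have Uinf := row_improper_unique _ _ hXinf hYinf.
have h1 : (N (fun w => X t w - Yinf w)%R <= (2 * (e / 4) + 2 * 0)%:E)%E.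
  apply: mean_sqr_le2_fin ht _; first exact: measurable_funB.
  - exact: measurable_funB.
  - exact: (measurable_funB mXinf mYinf).
  - by move=> w /=; ring.
  - by rewrite Uinf.
rewrite (_ : e = 2 * 0 + 2 * (2 * (e / 4) + 2 * 0)); last by field.
apply: mean_sqr_le2_fin h1; first exact: measurable_funB.
- exact: (measurable_funB mY mX).
- exact: measurable_funB.
- by move=> w /=; ring.
- by rewrite U.
Qed.

(** Compare X t with the integral of h over [0, m] for m >= t large: the latter is
close to Xinf, and row_lower_bound bounds the distance of the integrands over
the smaller interval [0, t]. *)
Lemma row_kernel_cvg k :
  (\int[mu]_(s in `[0%R, t]) ((g t k s - h k s)%R ^+ 2)%:E)%E
    @[t --> +oo%R] --> 0%E.
Proof.
have m20 : 0 < m2 by exact: normal_moment2_gt0.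
apply: near_cvg0e.
  by apply: nearW => t; apply: integral_ge0 => s _; rewrite lee_fin sqr_ge0.
move=> e e0; pose a := e * m2 / 64.
have a0 : 0 < a by rewrite divr_gt0// mulr_gt0.
have near0 : \forall t \near +oo%R, 0 <= t :> R by exact: nbhs_pinfty_ge.
apply: (filterS _ (filterI near0 (cvg0e_near _ _ _ _ _ row_L2_cvg a0))) => t [t0 /ltW ht].
have [_ lim] := row_improper _ hXinf.
have [n hn] := lim _ a0.
case: (hXinf) => mXinf [Y [hY _]].
(* Both requirements on m: beyond n for the convergence, beyond t for the bound. *)
pose m := maxn n (Num.truncn t).+1.
have tm : t <= m%:R.
  by rewrite ltW// (lt_le_trans (truncnS_gt t))// ler_nat leq_maxr.
have Ym := hY m%:R (ler0n _ _).
have mX := row_meas _ _ _ (hX _ t0); have mY := row_meas _ _ _ Ym.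
have h1 : (N (fun w => X t w - Y m%:R w)%R <= (2 * a + 2 * a)%:E)%E.
  apply: mean_sqr_le2_fin ht _; first exact: measurable_funB.
  - exact: measurable_funB.
  - exact: (measurable_funB mXinf mY).
  - by move=> w /=; ring.
  - rewrite (@mean_sqr_opp _ _ _ _ _ (fun w => Y m%:R w - Xinf w)); last by move=> w; rewrite opprB.
    by apply: (hn m) => //; exact: leq_maxl.
apply: le_trans (row_lower_bound hB _ _ _ _ _ _ _ k t0 tm (cg _ t0) (ch _ (ler0n _ _))
  (hX _ t0) Ym h1) _.
by rewrite lee_fin /a le_eqVlt; apply/orP; left; apply/eqP; field; rewrite gt_eqF.
Qed.

End row_limits.

(** * Continuity of the integrands *)

Section continuity.
Context {R : realType}.

Lemma within_entry_mulmx n p q (A : set R) (F : R -> 'M[R]_(n, p)) (f : R -> 'M[R]_(p, q)) i k :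
  {within A, continuous F} -> {within A, continuous f} ->
  {within A, continuous (fun s => (F s *m f s) i k)}.
Proof.
move=> cF cf; have -> : (fun s => (F s *m f s) i k) = fun s => \sum_j F s i j * f s j k.
  by apply/funext => s; rewrite mxE.
move=> s; apply: cvg_big => [|j _]; first exact: add_continuous.
  apply: cvgM.
  by apply: (cvg_comp F (fun M : 'M[R]_(n, p) => M i j) (cF s)); exact: coord_continuous.
by apply: (cvg_comp f (fun M : 'M[R]_(p, q) => M j k) (cf s)); exact: coord_continuous.
Qed.

Lemma within_slice n (H : R -> R -> 'M[R]_n) t :
  {within [set p : R * R | 0 <= p.2 /\ p.2 <= p.1], continuous (fun p : R * R => H p.1 p.2)} ->
  {within `[0, t], continuous (H t)}.
Proof.
move=> /subspace_continuousP hH; apply/subspace_continuousP => s /=.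
rewrite in_itv/= => /andP[s0 st].
move=> U /(hH (t, s) (conj s0 st)) hU.
have pairc : (t, s') @[s' --> s] --> (t, s).
  by apply: (@cvg_pair _ _ _ _ (nbhs t) (nbhs s)); [exact: cvg_cst|exact: cvg_id].
suff : \forall s' \near s, `[0, t]%classic s' -> U (H t s') by [].
have : \forall s' \near s, 0 <= s' /\ s' <= t -> U (H t s') by exact: (pairc _ hU).
by apply: filterS => s' hs'; rewrite /= in_itv/= => /andP.
Qed.

End continuity.

Theorem theorem4 (R : realType) (d' : measure_display)
    (Omega : measurableType d') (P : probability Omega R) (n d : nat)
    (hn : (0 < n)%N) (hd : (0 < d)%N)
    (H : R -> R -> 'M[R]_n)
    (hH : {within [set p : R * R | 0 <= p.2 /\ p.2 <= p.1],
             continuous (fun p : R * R => H p.1 p.2)})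
    (B : 'I_d -> R -> Omega -> R) (hB : brownian_vector P B)
    (Hinf : R -> 'M[R]_n) (hHinf : {within `[0, +oo[, continuous Hinf})
    (hlim : forall f : R -> 'M[R]_(n, d), bounded_continuous f ->
       exists (X : R -> Omega -> 'cV[R]_n) (Xinf : Omega -> 'cV[R]_n),
         [/\ forall t, 0 <= t ->
               is_ito_integral_mx P B (fun s _ => H t s *m f s) t (X t),
             is_improper_ito_integral_mx P B (fun s _ => Hinf s *m f s) Xinf
           & {ae P, forall w, X t w @[t --> +oo%R] --> Xinf w}]) :
  ((\int[lebesgue_measure]_(s in `[0%R, t])
      (frobenius_norm (H t s - Hinf s)%R ^+ 2)%:E)%E
     @[t --> +oo%R] --> 0%E) /\
  (forall f : R -> 'M[R]_(n, d), bounded_continuous f ->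
     forall (X : R -> Omega -> 'cV[R]_n) (Xinf : Omega -> 'cV[R]_n),
       (forall t, 0 <= t ->
          is_ito_integral_mx P B (fun s _ => H t s *m f s) t (X t)) ->
       is_improper_ito_integral_mx P B (fun s _ => Hinf s *m f s) Xinf ->
       ('E_P[fun w => (frobenius_norm (X t w - Xinf w) ^+ 2)%R])%E
         @[t --> +oo%R] --> 0%E).
Proof.
have cH0 t : {within `[0, t], continuous (H t)} by exact: within_slice hH.
have cHinf t : {within `[0, t], continuous Hinf}.
  apply: continuous_subspaceW hHinf => s /=; rewrite !in_itv/= andbT.
  by case/andP.
have cf (f : R -> 'M[R]_(n, d)) t : bounded_continuous f -> {within `[0, t], continuous f}.
  move=> [cf _]; apply: continuous_subspaceW cf => s /=; rewrite !in_itv/= andbT.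
  by case/andP.
pose g (f : R -> 'M[R]_(n, d)) (i : 'I_n) t (k : 'I_d) s := (H t s *m f s) i k.
pose h (f : R -> 'M[R]_(n, d)) (i : 'I_n) (k : 'I_d) s := (Hinf s *m f s) i k.
have cg f i : bounded_continuous f ->
    forall t, 0 <= t -> forall k, {within `[0, t], continuous (g f i t k)}.
  by move=> bf t _ k; apply: within_entry_mulmx => //; exact: cf.
have ch f i : bounded_continuous f ->
    forall t, 0 <= t -> forall k, {within `[0, t], continuous (h f i k)}.
  by move=> bf t _ k; apply: within_entry_mulmx => //; exact: cf.
have row f t X i : is_ito_integral_mx P B (fun s _ => H t s *m f s) t X ->
    @is_row_ito _ _ _ P _ B (g f i t) t (fun w => X w i 0) by exact.
have row_inf f X i : is_improper_ito_integral_mx P B (fun s _ => Hinf s *m f s) X ->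
    @is_row_improper _ _ _ P _ B (h f i) (fun w => X w i 0).
  move=> [mX [Y [hY Ycvg]]]; split; first exact: mX.
  exists (fun t w => Y t w i 0); split; first by move=> t t0; exact: hY.
  apply: (filterS _ Ycvg) => w Yw.
  by apply: (cvg_comp (fun t => Y t w) (fun M : 'cV[R]_n => M i 0) Yw); exact: coord_continuous.
have coord (X : R -> Omega -> 'cV[R]_n) (Xinf : Omega -> 'cV[R]_n) i :
    {ae P, forall w, X t w @[t --> +oo%R] --> Xinf w} ->
    {ae P, forall w, X t w i 0 @[t --> +oo%R] --> Xinf w i 0}.
  move=> Xc; apply: (filterS _ Xc) => w Xw.
  by apply: (cvg_comp (fun t => X t w) (fun M : 'cV[R]_n => M i 0) Xw); exact: coord_continuous.
have frob p q (M : 'M[R]_(p, q)) : frobenius_norm M ^+ 2 = \sum_i \sum_j M i j ^+ 2.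
  rewrite /frobenius_norm sqr_sqrtr//; apply: sumr_ge0 => i _.
  by apply: sumr_ge0 => j _; exact: sqr_ge0.
split.
  (* Entry (i, j): the constant matrix delta_mx j k0 moves column j of H - Hinf to
     the direction k0. *)
  have k0 : 'I_d := Ordinal hd.
  have J i j : (\int[lebesgue_measure]_(s in `[0%R, t]) ((H t s i j - Hinf s i j)%R ^+ 2)%:E)%E
      @[t --> +oo%R] --> 0%E.
    pose f (_ : R) : 'M[R]_(n, d) := delta_mx j k0.
    have bf : bounded_continuous f.
      split; first by apply: continuous_subspaceT => s; exact: cvg_cst.
      by exists (frobenius_norm (delta_mx j k0 : 'M[R]_(n, d))).
    have [X [Xinf [hX hXinf Xc]]] := hlim f bf.
    have entry (A : 'M[R]_n) : (A *m f 0) i k0 = A i j.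
      rewrite mxE (bigD1 j)//= mxE !eqxx mulr1 big1 ?addr0// => l lj.
      by rewrite mxE (negbTE lj) mulr0.
    have := row_kernel_cvg hB (h f i) (ch f i bf) (g f i) (cg f i bf)
      (fun t w => X t w i 0) (fun w => Xinf w i 0)
      (fun t t0 => row _ _ _ _ (hX t t0)) (row_inf _ _ _ hXinf) (coord _ _ _ Xc) k0.
    rewrite /g /h; under eq_fun do under eq_integral do rewrite !entry.
    exact.
  have S : (\sum_i \sum_j \int[lebesgue_measure]_(s in `[0%R, t])
      ((H t s i j - Hinf s i j)%R ^+ 2)%:E)%E @[t --> +oo%R] -->
      (\sum_(i < n) \sum_(j < n) 0 : \bar R)%E.
    apply: cvg_nnesum => [i _|i _].
      apply: nearW => t; apply: sume_ge0 => j _; apply: integral_ge0 => s _.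
      by rewrite lee_fin sqr_ge0.
    apply: cvg_nnesum => [j _|j _]; last exact: J.
    by apply: nearW => t; apply: integral_ge0 => s _; rewrite lee_fin sqr_ge0.
  rewrite (_ : (\sum_(i < n) \sum_(j < n) 0 : \bar R)%E = 0%E) in S; last first.
    by rewrite big1// => i _; rewrite big1.
  apply: cvg_trans S; apply: near_eq_cvg; apply: nearW => t.
  have mentry i j : measurable_fun `[0, t] (fun s => ((H t s i j - Hinf s i j)%R ^+ 2)%:E).
    have ent (G : R -> 'M[R]_n) : {within `[0, t], continuous G} ->
        measurable_fun `[0, t] (fun s => G s i j).
      move=> cG; apply: subspace_continuous_measurable_fun => // s.
      by apply: (cvg_comp G (fun M : 'M[R]_n => M i j) (cG s)); exact: coord_continuous.
    by apply/measurable_EFinP; apply: measurable_funX; apply: measurable_funB; exact: ent.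
  transitivity (\int[lebesgue_measure]_(s in `[0%R, t])
      (\sum_i \sum_j ((H t s i j - Hinf s i j)%R ^+ 2)%:E))%E.
    rewrite ge0_integral_sum//; last 2 first.
    - by move=> i; apply: emeasurable_sum => j; exact: mentry.
    - by move=> i s _; apply: sume_ge0 => j _; rewrite lee_fin sqr_ge0.
    apply: eq_bigr => i _; rewrite ge0_integral_sum//; last 1 first.
    - by move=> j s _; rewrite lee_fin sqr_ge0.
    - by move=> j; exact: mentry.
  apply: eq_integral => s _; rewrite frob -sumEFin; apply: eq_bigr => i _.
  by rewrite -sumEFin; apply: eq_bigr => j _; rewrite !mxE.
move=> f bf Y Yinf hY hYinf.
have [X [Xinf [hX hXinf Xc]]] := hlim f bf.
have S i := row_L2_cvg_version hB (h f i) (ch f i bf) (g f i) (cg f i bf)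
  (fun t w => X t w i 0) (fun w => Xinf w i 0)
  (fun t t0 => row _ _ _ _ (hX t t0)) (row_inf _ _ _ hXinf) (coord _ _ _ Xc)
  (fun t w => Y t w i 0) (fun w => Yinf w i 0)
  (fun t t0 => row _ _ _ _ (hY t t0)) (row_inf _ _ _ hYinf).
have {}S : (\sum_(i < n) mean_sqr P (fun w => (Y t w i 0 - Yinf w i 0)%R))%E @[t --> +oo%R] --> 0%E.
  rewrite [X in _ --> X](_ : _ = (\sum_(i < n) 0 : \bar R)%E); last by rewrite big1.
  apply: cvg_nnesum => i _; last exact: S.
  by apply: nearW => t; exact: mean_sqr_ge0.
apply: cvg_trans S; apply: near_eq_cvg; near=> t.
have t0 : 0 <= t by near: t; exact: nbhs_pinfty_ge.
rewrite expectation.unlock.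
transitivity (\int[P]_w (\sum_(i < n) ((Y t w i 0 - Yinf w i 0)%R ^+ 2)%:E))%E.
  rewrite ge0_integral_sum//; last 2 first.
  - move=> i; apply/measurable_EFinP; apply: measurable_funX; apply: measurable_funB.
      exact: row_meas (row _ _ _ i (hY t t0)).
    by case: hYinf => mY _; exact: mY.
  - by move=> i w _; rewrite lee_fin sqr_ge0.
apply: eq_integral => w _; rewrite frob -sumEFin; apply: eq_bigr => i _.
by rewrite big_ord1 !mxE.
Unshelve. all: by end_near. Qed.
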